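(* Let $\mathcal{V}$ be a vector space over $\mathbb{C}$ and let $\Delta:\mathcal{V}\to\mathcal{V}\otimes\mathcal{V}$ be a linear map. Let $\underline{\chi}\in\mathfrak{M}_{\mathcal{V}}$, and let $$\underline{\varphi}':=\Delta^*(\underline{\beta}_{\underline{\chi}}),$$ where $\underline{\beta}_{\underline{\chi}}\in\mathfrak{M}_{\mathcal{V}}$ is the family of Boolean cumulants associated to $(\mathcal{V},\underline{\chi})$ and $\Delta^*:\mathfrak{M}_{\mathcal{V}}\to\mathfrak{M}_{\mathcal{V}}$ is the transformation constructed from $\Delta$. Then for any tracial $\underline{\varphi}\in\mathfrak{M}_{\mathcal{V}}$ the following happens: denoting the c-free cumulants of $(\mathcal{V},\underline{\varphi},\underline{\chi})$ by $\underline{\kappa}^{(c)}$ and denoting the infinitesimal free cumulants of $(\mathcal{V},\underline{\varphi},\underline{\varphi}')$ by $\underline{\kappa}'$, one has the relation $$\underline{\kappa}'=\Delta^*(\underline{\kappa}^{(c)}).$$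
   Context: Families of functionals. $\mathfrak{M}_{\mathcal{V}}$ is the set of sequences $\underline{\varphi}=(\varphi_n)_{n=1}^\infty$ with $\varphi_n:\mathcal{V}^n\to\mathbb{C}$ multilinear for every $n\ge1$. $\underline\varphi$ is tracial if $\varphi_n(x_2,\ldots,x_n,x_1)=\varphi_n(x_1,\ldots,x_n)$ for all $n\ge2$ and $x_1,\ldots,x_n\in\mathcal{V}$. Transformation $\Delta^*$. For $1\le m\le n$ let $\Delta_n^{(m)}:\mathcal{V}^{\otimes n}\to\mathcal{V}^{\otimes(n+1)}$ be the linear map with $\Delta_n^{(m)}(x_1\otimes\cdots\otimes x_n)=x_1\otimes\cdots\otimes x_{m-1}\otimes(\Delta x_m)\otimes x_{m+1}\otimes\cdots\otimes x_n$. Let $\Gamma_n:\mathcal{V}^{\otimes n}\to\mathcal{V}^{\otimes n}$ be the linear map with $\Gamma_n(x_1\otimes\cdots\otimes x_n)=x_2\otimes\cdots\otimes x_n\otimes x_1$. Put $\widetilde{\Delta}_n=\sum_{m=1}^n\Gamma_{n+1}^m\circ\Delta_n^{(m)}$ (where $\Gamma_{n+1}^m$ is the $m$-th power under composition). For $\underline\varphi=(\varphi_n)_{n=1}^\infty\in\mathfrak{M}_{\mathcal{V}}$ define $\Delta^*(\underline\varphi):=(\psi_n)_{n=1}^\infty$ with $\psi_n:=\varphi_{n+1}\circ\widetilde\Delta_n$, where multilinear functionals on $\mathcal{V}^n$ are identified with linear functionals on $\mathcal{V}^{\otimes n}$. Partitions. $NC(n)$ is the set of non-crossing partitions of $\{1,\ldots,n\}$;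 $\mathrm{Int}(n)\subseteq NC(n)$ is the set of interval partitions (every block is a set of consecutive integers). A block $V$ of $\pi\in NC(n)$ is inner if there is a block $W$ of $\pi$ with $\min W<\min V\le\max V<\max W$; otherwise it is outer. For $M=\{i_1<\cdots<i_m\}\subseteq\{1,\ldots,n\}$, $(x_1,\ldots,x_n)\mid M:=(x_{i_1},\ldots,x_{i_m})$. Cumulants. For $\underline\varphi,\underline\chi,\underline\varphi'\in\mathfrak{M}_{\mathcal{V}}$, the following elements of $\mathfrak{M}_{\mathcal{V}}$ are uniquely determined by the stated identities, required for all $n\ge1$ and $x_1,\ldots,x_n\in\mathcal{V}$. - Free cumulants $(\kappa_{n;\underline\varphi})_n$ of $(\mathcal V,\underline\varphi)$: $\varphi_n(x_1,\ldots,x_n)=\sum_{\pi\in NC(n)}\prod_{V\in\pi}\kappa_{|V|;\underline\varphi}((x_1,\ldots,x_n)\mid V)$. - Boolean cumulants $\underline\beta_{\underline\chi}=(\beta_{n;\underline\chi})_n$ of $(\mathcal V,\underline\chi)$: $\chi_n(x_1,\ldots,x_n)=\sum_{\pi\in\mathrm{Int}(n)}\prod_{V\in\pi}\beta_{|V|;\underline\chi}((x_1,\ldots,x_n)\mid V)$. - c-free cumulants $\underline\kappa^{(c)}=(\kappa^{(c)}_n)_n$ of $(\mathcal{V},\underline\varphi,\underline\chi)$: $\chi_n(x_1,\ldots,x_n)=\sum_{\pi\in NC(n)}\prod_{V\in\pi\text{ inner}}\kappa_{|V|;\underline\varphi}((x_1,\ldots,x_n)\mid V)\prod_{W\in\pi\text{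 outer}}\kappa^{(c)}_{|W|}((x_1,\ldots,x_n)\mid W)$. - Infinitesimal free cumulants $\underline\kappa'=(\kappa'_n)_n$ of $(\mathcal{V},\underline\varphi,\underline\varphi')$: $\varphi'_n(x_1,\ldots,x_n)=\sum_{\pi\in NC(n)}\sum_{V_o\in\pi}\kappa'_{|V_o|}((x_1,\ldots,x_n)\mid V_o)\prod_{V\in\pi,V\ne V_o}\kappa_{|V|;\underline\varphi}((x_1,\ldots,x_n)\mid V)$. *)

(* Defs.v *)
From HB Require Import structures.
From mathcomp Require Import all_boot all_order all_algebra.
From mathcomp Require Import boolp reals complex zify.

Set Implicit Arguments.
Unset Strict Implicit.
Unset Printing Implicit Defensive.

Import GRing.Theory.
Local Open Scope ring_scope.
Local Open Scope quotient_scope.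

Definition tset (T : Type) (n : nat) (x : n.-tuple T) (i : 'I_n) (u : T) :
  n.-tuple T := [tuple if j == i then u else tnth x j | j < n].

Definition multilinear (K : fieldType) (V W : lmodType K) (n : nat)
    (f : n.-tuple V -> W) : Prop :=
  forall (x : n.-tuple V) (i : 'I_n) (c : K) (u v : V),
    f (tset x i (c *: u + v)) = c *: f (tset x i u) + f (tset x i v).

Record multilin (K : fieldType) (V W : lmodType K) (n : nat) := Multilin {
  multilin_fun :> n.-tuple V -> W;
  multilinP : multilinear multilin_fun }.

(* [tensor V n] is the [n]-th tensor power of [V]: formal linear combinations
   of [n]-tuples of vectors, modulo the smallest congruence which makes them a
   vector space in which [tens] is multilinear.  The universal property is
   given by [tlift], [tlift_tens] and [tens_linear_ext]. *)

Section TensorPower.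
Variables (K : fieldType) (V : lmodType K).

Definition formal n := seq (K * n.-tuple V).

Inductive tensor_eq n : formal n -> formal n -> Prop :=
| teq_refl s : tensor_eq s s
| teq_sym s t : tensor_eq s t -> tensor_eq t s
| teq_trans s t r : tensor_eq s t -> tensor_eq t r -> tensor_eq s r
| teq_cat s s' t t' :
    tensor_eq s s' -> tensor_eq t t' -> tensor_eq (s ++ t) (s' ++ t')
| teq_catC s t : tensor_eq (s ++ t) (t ++ s)
| teq_coef0 x : tensor_eq [:: (0, x)] [::]
| teq_coefD a b x : tensor_eq [:: (a + b, x)] [:: (a, x); (b, x)]
| teq_linear a x i c u v :
    tensor_eq [:: (a, tset x i (c *: u + v))]
              [:: (a * c, tset x i u); (a, tset x i v)].

Definition tensor_eqb n : rel (formal n) := fun s t => `[< tensor_eq s t >].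

Lemma tensor_eqb_refl n : reflexive (@tensor_eqb n).
Proof. by move=> s; apply/asboolP; exact: teq_refl. Qed.

Lemma tensor_eqb_sym n : symmetric (@tensor_eqb n).
Proof. by move=> s t; apply/asboolP/asboolP; exact: teq_sym. Qed.

Lemma tensor_eqb_trans n : transitive (@tensor_eqb n).
Proof.
by move=> t s r /asboolP st /asboolP tr; apply/asboolP; exact: teq_trans tr.
Qed.

Canonical tensor_equiv n :=
  EquivRel (@tensor_eqb n) (@tensor_eqb_refl n) (@tensor_eqb_sym n)
           (@tensor_eqb_trans n).

Definition tensor n := {eq_quot (tensor_equiv n)}.

HB.instance Definition _ n := Choice.on (tensor n).

Definition tclass n (s : formal n) : tensor n := \pi_(tensor n) s.

Lemma tclassP n (s t : formal n) : tclass s = tclass t <-> tensor_eq s t.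
Proof.
split=> [/eqmodP /asboolP //|st]; apply/eqmodP; exact/asboolP.
Qed.

Lemma tclass_repr n (X : tensor n) : tclass (repr X) = X.
Proof. exact: reprK. Qed.

Lemma repr_tclass n (s : formal n) : tensor_eq (repr (tclass s)) s.
Proof. by apply/tclassP; rewrite tclass_repr. Qed.

Definition fscale n (a : K) (s : formal n) : formal n :=
  [seq (a * p.1, p.2) | p <- s].

Lemma fscale_eq n a (s t : formal n) :
  tensor_eq s t -> tensor_eq (fscale a s) (fscale a t).
Proof.
rewrite /fscale; elim=> {s t}.
- by move=> s; exact: teq_refl.
- by move=> s t _; exact: teq_sym.
- by move=> s t r _ + _; exact: teq_trans.
- by move=> s s' t t' _ + _; rewrite !map_cat; exact: teq_cat.
- by move=> s t; rewrite !map_cat; exact: teq_catC.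
- by move=> x /=; rewrite mulr0; exact: teq_coef0.
- by move=> b c x /=; rewrite mulrDr; exact: teq_coefD.
- by move=> b x i c u v /=; rewrite mulrA; exact: teq_linear.
Qed.

Lemma fscaleDl n a b (s : formal n) :
  tensor_eq (fscale (a + b) s) (fscale a s ++ fscale b s).
Proof.
elim: s => [|p s IHs]; first exact: teq_refl.
have catCA (s1 s2 s3 : formal n) :
    tensor_eq (s1 ++ s2 ++ s3) (s2 ++ s1 ++ s3).
  by rewrite !catA; apply: teq_cat (teq_refl _); exact: teq_catC.
rewrite /fscale /= mulrDl -!/(fscale _ _) -cat1s.
apply: teq_trans (teq_cat (teq_coefD _ _ _) IHs) _.
apply: (@teq_cat _ [:: _] [:: _] (_ :: _) (_ ++ _ :: _)).
  exact: teq_refl.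
exact: (catCA [:: _]).
Qed.

Lemma fscale0 n (s : formal n) : tensor_eq (fscale 0 s) [::].
Proof.
elim: s => [|p s IHs]; first exact: teq_refl.
by rewrite /fscale /= mul0r -cat1s -[[::]]/([::] ++ [::]); apply: teq_cat (teq_coef0 _) IHs.
Qed.

Definition tadd n (X Y : tensor n) : tensor n := tclass (repr X ++ repr Y).
Definition tscale n (a : K) (X : tensor n) : tensor n :=
  tclass (fscale a (repr X)).
Definition topp n (X : tensor n) : tensor n := tscale (-1) X.

Lemma tadd_class n (s t : formal n) :
  tadd (tclass s) (tclass t) = tclass (s ++ t).
Proof. by apply/tclassP; apply: teq_cat; exact: repr_tclass. Qed.

Lemma tscale_class n a (s : formal n) :
  tscale a (tclass s) = tclass (fscale a s).
Proof. by apply/tclassP; apply: fscale_eq; exact: repr_tclass. Qed.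

Lemma tensorW n (P : tensor n -> Prop) :
  (forall s, P (tclass s)) -> forall X, P X.
Proof. by move=> Ps X; rewrite -[X]tclass_repr. Qed.

Fact taddA n : associative (@tadd n).
Proof.
move=> X Y Z; elim/tensorW: X => s; elim/tensorW: Y => t; elim/tensorW: Z => r.
by rewrite !tadd_class catA.
Qed.

Fact taddC n : commutative (@tadd n).
Proof.
move=> X Y; elim/tensorW: X => s; elim/tensorW: Y => t.
by rewrite !tadd_class; apply/tclassP; exact: teq_catC.
Qed.

Fact tadd0 n : left_id (tclass [::]) (@tadd n).
Proof. by move=> X; elim/tensorW: X => s; rewrite tadd_class. Qed.

Fact tscaleA n a b (X : tensor n) : tscale a (tscale b X) = tscale (a * b) X.
Proof.
elim/tensorW: X => s; rewrite !tscale_class /fscale -map_comp.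
by congr tclass; apply: eq_map => p /=; rewrite mulrA.
Qed.

Fact tscale1 n : left_id 1 (@tscale n).
Proof.
move=> X; elim/tensorW: X => s; rewrite tscale_class /fscale.
by congr tclass; rewrite -[RHS]map_id; apply: eq_map => -[a x] /=; rewrite mul1r.
Qed.

Fact tscaleDr n : right_distributive (@tscale n) (@tadd n).
Proof.
move=> a X Y; elim/tensorW: X => s; elim/tensorW: Y => t.
by rewrite !(tadd_class, tscale_class) /fscale map_cat.
Qed.

Fact tscaleDl n (X : tensor n) :
  {morph (@tscale n)^~ X : a b / a + b >-> tadd a b}.
Proof.
move=> a b; elim/tensorW: X => s.
by rewrite !(tscale_class, tadd_class); apply/tclassP; exact: fscaleDl.
Qed.

Fact taddN n : left_inverse (tclass [::]) (@topp n) (@tadd n).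
Proof.
move=> X; rewrite /topp -{2}[X]tscale1 -tscaleDl addNr.
by elim/tensorW: X => s; rewrite tscale_class; apply/tclassP; exact: fscale0.
Qed.

HB.instance Definition _ n :=
  GRing.isZmodule.Build (tensor n) (@taddA n) (@taddC n) (@tadd0 n) (@taddN n).

HB.instance Definition _ n :=
  GRing.Zmodule_isLmodule.Build K (tensor n)
    (@tscaleA n) (@tscale1 n) (@tscaleDr n) (@tscaleDl n).

Definition tens_fun n (x : n.-tuple V) : tensor n := tclass [:: (1, x)].

Lemma tclassE n (s : formal n) :
  tclass s = \sum_(p <- s) p.1 *: tens_fun p.2.
Proof.
elim: s => [|[a x] s IHs]; first by rewrite big_nil.
rewrite big_cons -IHs /= -cat1s -tadd_class.
congr (_ + _); rewrite /tens_fun [RHS]tscale_class.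
by rewrite /fscale /= mulr1.
Qed.

Lemma tens_subproof n : multilinear (@tens_fun n).
Proof.
move=> x i c u v.
rewrite [LHS](_ : _ = tclass [:: (1 * c, tset x i u); (1, tset x i v)]).
  by rewrite tclassE !big_cons big_nil /= scale1r addr0 mul1r.
by apply/tclassP; exact: teq_linear.
Qed.

Definition tens n := Multilin (@tens_subproof n).

Lemma tens_span n (X : tensor n) :
  exists s : formal n, X = \sum_(p <- s) p.1 *: tens n p.2.
Proof. by exists (repr X); rewrite -[LHS]tclass_repr tclassE. Qed.

Section Lift.
Variables (W : lmodType K) (n : nat) (f : multilin V W n).

Definition feval (s : formal n) : W := \sum_(p <- s) p.1 *: f p.2.

Definition tlift (X : tensor n) : W := feval (repr X).

Lemma feval_eq s t : tensor_eq s t -> feval s = feval t.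
Proof.
rewrite /feval; elim=> {s t} //.
- by move=> s t r _ -> _.
- by move=> s s' t t' _ IHs _ IHt; rewrite !big_cat /= IHs IHt.
- by move=> s t; rewrite !big_cat /= addrC.
- by move=> x; rewrite big_seq1 big_nil scale0r.
- by move=> a b x; rewrite big_seq1 !big_cons big_nil /= addr0 scalerDl.
- move=> a x i c u v; rewrite big_seq1 !big_cons big_nil /= addr0.
  by rewrite multilinP scalerDr scalerA.
Qed.

Lemma tlift_class s : tlift (tclass s) = feval s.
Proof. exact: feval_eq (repr_tclass s). Qed.

Fact tlift_subproof : linear tlift.
Proof.
move=> a X Y; elim/tensorW: X => s; elim/tensorW: Y => t.
have -> : a *: tclass s + tclass t = tclass (fscale a s ++ t).
  by rewrite -tadd_class -tscale_class.
rewrite !tlift_class /feval big_cat /= scaler_sumr; congr (_ + _).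
by rewrite /fscale big_map; apply: eq_bigr => p _ /=; rewrite scalerA.
Qed.

HB.instance Definition _ :=
  GRing.isLinear.Build K (tensor n) W _ tlift tlift_subproof.

Lemma tlift_tens x : tlift (tens n x) = f x.
Proof. by rewrite /= /tens_fun tlift_class /feval big_seq1 scale1r. Qed.

Lemma tlift_sum (s : formal n) :
  tlift (\sum_(p <- s) p.1 *: tens n p.2) = \sum_(p <- s) p.1 *: f p.2.
Proof. by rewrite -[\sum_(p <- s) _]tclassE tlift_class. Qed.

End Lift.

Lemma tens_linear_ext (W : lmodType K) n (g h : {linear tensor n -> W}) :
  (forall x, g (tens n x) = h (tens n x)) -> g =1 h.
Proof.
move=> gh X; have [s ->] := tens_span X; rewrite !linear_sum.
by apply: eq_bigr => p _; rewrite !linearZ /= gh.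
Qed.

End TensorPower.

Arguments tens {K V} n : simpl never.

(* Indices start at 0, so [Delta_nm m] with [m : 'I_n] applies [Delta] to the
   factor number [m.+1]; hence the power [m.+1] of [Gamma] in [Delta_tilde]. *)

Section DeltaStar.
Variables (K : fieldType) (V : lmodType K).

Lemma tset_nth (T : Type) (x0 : T) n (x : n.-tuple T) i u (j : nat) :
  (j < n)%N ->
  nth x0 (tset x i u) j = if j == i :> nat then u else nth x0 x j.
Proof.
by move=> jn; rewrite -[j]/(val (Ordinal jn)) -!tnth_nth tnth_mktuple.
Qed.

Lemma rot_nth n (x : n.-tuple V) (k : 'I_n) :
  tnth [tuple of rot 1 x] k = nth 0 x (if k.+1 == n then 0 else k.+1).
Proof.
have kn := ltn_ord k.
rewrite (tnth_nth 0) /= /rot nth_cat size_drop size_tuple.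
case: ltnP => k1; first by rewrite nth_drop; congr nth; case: eqP; lia.
by rewrite nth_take; [congr nth; case: eqP; lia | lia].
Qed.

Lemma rot_tset n (x : n.-tuple V) (i : 'I_n) :
  exists j : 'I_n, forall u, [tuple of rot 1 (tset x i u)] =
                             tset [tuple of rot 1 x] j u.
Proof.
have iltn := ltn_ord i.
have jP : ((if i == 0 :> nat then n.-1 else i.-1) < n)%N by case: ifP; lia.
exists (Ordinal jP) => u; apply: eq_from_tnth => k; have kn := ltn_ord k.
rewrite [RHS]tnth_mktuple !rot_nth -val_eqE /= tset_nth; last by case: ifP; lia.
by congr (if _ then _ else _); do 2?case: ifP; lia.
Qed.

Fact Gamma_subproof n :
  multilinear (fun x : n.-tuple V => tens n [tuple of rot 1 x]).
Proof.
by move=> x i c u v; have [j E] := rot_tset x i; rewrite !E multilinP.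
Qed.

Definition Gamma n : tensor V n -> tensor V n :=
  tlift (Multilin (@Gamma_subproof n)).

HB.instance Definition _ n := GRing.Linear.on (@Gamma n).

Lemma GammaE n (x : n.-tuple V) :
  Gamma (tens n x) = tens n [tuple of rot 1 x].
Proof. exact: tlift_tens. Qed.

(* (x_1, ..., x_{m-1}, a, b, x_{m+1}, ..., x_n) for ab = (a, b) *)
Definition subst2 n (x : n.-tuple V) (m : 'I_n) (ab : 2.-tuple V) :
    n.+1.-tuple V :=
  [tuple nth 0 (take m x ++ ab ++ drop m.+1 x) j | j < n.+1].

Lemma subst2_nth n (x : n.-tuple V) (m : 'I_n) (ab : 2.-tuple V) (j : 'I_n.+1) :
  tnth (subst2 x m ab) j =
  if (j < m)%N then nth 0 x j
  else if (j < m.+2)%N then nth 0 ab (j - m) else nth 0 x j.-1.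
Proof.
have mn := ltn_ord m; have jn := ltn_ord j.
rewrite tnth_mktuple !nth_cat size_takel; last by rewrite size_tuple ltnW.
rewrite size_tuple; case: ltnP => jm; first by rewrite nth_take.
rewrite ltn_subLR // addn2; case: ltnP => // mj.
by rewrite nth_drop; congr nth; lia.
Qed.

Lemma subst2_tset_ab n (x : n.-tuple V) (m : 'I_n) (ab : 2.-tuple V) (i : 'I_2) :
  exists j, forall u, subst2 x m (tset ab i u) = tset (subst2 x m ab) j u.
Proof.
have mn := ltn_ord m; have i2 := ltn_ord i.
have jP : (m + i < n.+1)%N by lia.
exists (Ordinal jP) => u; apply: eq_from_tnth => k.
rewrite [RHS]tnth_mktuple !subst2_nth -val_eqE /=.
case: ltnP => km; first by rewrite ifF //; lia.
case: ltnP => k2; last by rewrite ifF //; lia.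
by rewrite tset_nth; [congr (if _ then _ else _); lia | lia].
Qed.

Lemma subst2_tset_eq n (x : n.-tuple V) (m : 'I_n) (ab : 2.-tuple V) u :
  subst2 (tset x m u) m ab = subst2 x m ab.
Proof.
apply: eq_from_tnth => k; rewrite !subst2_nth.
have mn := ltn_ord m; have kn := ltn_ord k.
case: ltnP => km; first by rewrite tset_nth ?ifF //; lia.
by case: ltnP => // k2; rewrite tset_nth ?ifF //; lia.
Qed.

Lemma subst2_tset_neq n (x : n.-tuple V) (m i : 'I_n) (ab : 2.-tuple V) :
  i != m ->
  exists j, forall u, subst2 (tset x i u) m ab = tset (subst2 x m ab) j u.
Proof.
rewrite -val_eqE /= => im; have iltn := ltn_ord i.
have jP : ((if (i < m)%N then i : nat else i.+1) < n.+1)%N by case: ifP; lia.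
exists (Ordinal jP) => u; apply: eq_from_tnth => k.
rewrite [RHS]tnth_mktuple !subst2_nth -val_eqE /=.
have kn := ltn_ord k; have mn := ltn_ord m.
case: ltnP => km.
  rewrite tset_nth; last by lia.
  by congr (if _ then _ else _); case: ifP; lia.
case: ltnP => k2; first by rewrite ifF //; case: ifP; lia.
rewrite tset_nth; last by lia.
by congr (if _ then _ else _); case: ifP; lia.
Qed.

Fact subst2_subproof n (x : n.-tuple V) (m : 'I_n) :
  multilinear (fun ab : 2.-tuple V => tens n.+1 (subst2 x m ab)).
Proof.
move=> ab i c u v; have [j E] := subst2_tset_ab x m ab i.
by rewrite !E multilinP.
Qed.

(* x_1 (x) ... (x) x_{m-1} (x) t (x) x_{m+1} (x) ... (x) x_n *)
Definition subst_tens n (x : n.-tuple V) (m : 'I_n) :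
    tensor V 2 -> tensor V n.+1 :=
  tlift (Multilin (@subst2_subproof n x m)).

HB.instance Definition _ n (x : n.-tuple V) (m : 'I_n) :=
  GRing.Linear.on (@subst_tens n x m).

Lemma subst_tensE n (x : n.-tuple V) (m : 'I_n) (ab : 2.-tuple V) :
  subst_tens x m (tens 2 ab) = tens n.+1 (subst2 x m ab).
Proof. exact: tlift_tens. Qed.

Variable Delta : {linear V -> tensor V 2}.

Fact Delta_nm_subproof n (m : 'I_n) :
  multilinear (fun x : n.-tuple V => subst_tens x m (Delta (tnth x m))).
Proof.
move=> x i c u v; rewrite !tnth_mktuple.
have [<-{i}|im] := eqVneq m i.
  have E w : subst_tens (tset x m w) m =1 subst_tens x m.
    apply: tens_linear_ext => ab; apply: etrans (subst_tensE _ _ _) _.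
    by rewrite subst2_tset_eq -subst_tensE.
  by rewrite !E linearP linearP.
have [s ->] := tens_span (Delta (tnth x m)).
rewrite /subst_tens !tlift_sum scaler_sumr -big_split.
apply: eq_bigr => p _; rewrite [LHS]/= [RHS]/=.
have [|j E] := @subst2_tset_neq n x m i p.2; first by rewrite eq_sym.
by rewrite !E tens_subproof scalerDr !scalerA mulrC.
Qed.

Definition Delta_nm n (m : 'I_n) : tensor V n -> tensor V n.+1 :=
  tlift (Multilin (@Delta_nm_subproof n m)).

HB.instance Definition _ n (m : 'I_n) := GRing.Linear.on (@Delta_nm n m).

Lemma Delta_nmE n (m : 'I_n) (x : n.-tuple V) :
  Delta_nm m (tens n x) = subst_tens x m (Delta (tnth x m)).
Proof. exact: tlift_tens. Qed.

Definition Delta_tilde n (X : tensor V n) : tensor V n.+1 :=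
  \sum_(m < n) iter m.+1 (@Gamma n.+1) (Delta_nm m X).

Fact Delta_tilde_subproof n : linear (@Delta_tilde n).
Proof.
move=> a X Y; rewrite /Delta_tilde scaler_sumr -big_split /=.
apply: eq_bigr => m _; rewrite linearP -!iterS.
by elim: m.+1 => //= k ->; rewrite linearP.
Qed.

HB.instance Definition _ n :=
  GRing.isLinear.Build K (tensor V n) (tensor V n.+1) _ (@Delta_tilde n)
    (@Delta_tilde_subproof n).

(* Families (phi_n) for n >= 1.  The component at n = 0 is a dummy: no
   definition below lets it influence a component with n >= 1, and families
   are only ever compared at n >= 1. *)
Definition mfamily := forall n : nat, multilin V K^o n.

Fact Delta_star_subproof (phi : mfamily) n :
  multilinear (fun x : n.-tuple V =>
                 tlift (phi n.+1) (Delta_tilde (tens n x))).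
Proof. by move=> x i c u v; rewrite multilinP !linearP. Qed.

(* [tlift (phi n)] is the linear functional on the tensor power identified with
   the multilinear functional [phi n]. *)
Definition Delta_star (phi : mfamily) : mfamily :=
  fun n => Multilin (@Delta_star_subproof phi n).

End DeltaStar.

Definition noncrossing n (P : {set {set 'I_n}}) : bool :=
  [forall A in P, forall B in P,
    forall a in A, forall b in B, forall c in A, forall d in B,
      [&& a < b, b < c & c < d]%N ==> (A == B)].

Definition NC n : {set {set {set 'I_n}}} :=
  [set P | partition P [set: 'I_n] & noncrossing P].

Definition Int n : {set {set {set 'I_n}}} :=
  [set P in NC n | [forall A in P, forall a in A, forall c in A,
                     forall b : 'I_n, (a < b < c)%N ==> (b \in A)]].

Definition bmin n (A : {set 'I_n}) : nat := \big[minn/n]_(i in A) (i : nat).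
Definition bmax n (A : {set 'I_n}) : nat := \max_(i in A) (i : nat).

Definition inner n (P : {set {set 'I_n}}) (A : {set 'I_n}) : bool :=
  [exists B in P, [&& bmin B < bmin A, bmin A <= bmax A & bmax A < bmax B]%N].

(* [enum A], hence the tuple, lists the indices in increasing order. *)
Definition restr (T : Type) n (x : n.-tuple T) (A : {set 'I_n}) :
  #|A|.-tuple T := [tuple of [seq tnth x i | i in A]].

(* Each family of cumulants is characterized, among the multilinear families,
   by the identities which determine it (uniquely in degrees n >= 1). *)

Section Cumulants.
Variables (K : fieldType) (V : lmodType K).
Implicit Types phi chi kappa beta kappac : mfamily V.

Definition tracial phi : Prop :=
  forall n, (2 <= n)%N -> forall x : n.-tuple V,
    phi n [tuple of rot 1 x] = phi n x.

Definition free_cumulants phi kappa : Prop :=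
  forall n, (1 <= n)%N -> forall x : n.-tuple V,
    phi n x = \sum_(P in NC n) \prod_(A in P) kappa #|A| (restr x A).

Definition boolean_cumulants chi beta : Prop :=
  forall n, (1 <= n)%N -> forall x : n.-tuple V,
    chi n x = \sum_(P in Int n) \prod_(A in P) beta #|A| (restr x A).

Definition cfree_cumulants chi kappa kappac : Prop :=
  forall n, (1 <= n)%N -> forall x : n.-tuple V,
    chi n x = \sum_(P in NC n)
      (\prod_(A in P | inner P A) kappa #|A| (restr x A)) *
      (\prod_(A in P | ~~ inner P A) kappac #|A| (restr x A)).

Definition inf_free_cumulants (phi' kappa kappa' : mfamily V) : Prop :=
  forall n, (1 <= n)%N -> forall x : n.-tuple V,
    phi' n x = \sum_(P in NC n) \sum_(A0 in P)
      kappa' #|A0| (restr x A0) *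
      \prod_(A in P | A != A0) kappa #|A| (restr x A).

End Cumulants.

(* Main.v *)
(** Boolean cumulants are the c-free cumulants relative to [kappa = 0], and the
    c-free moment formula splits along the outer block containing the first
    point.  Comparing the two recursions in [chi] shows that [beta_(n+1)] is the
    sum over the non-crossing partitions of [n+1] points whose first and last
    points lie in one block, that block being weighted by [kappac] and all others
    by [kappa].  The [m]-th term of [Delta_star beta] evaluates [beta] on
    [b, x_(m+1), ..., x_n, x_1, ..., x_(m-1), a] where [a (x) b] comes from
    [Delta x_m].  Gluing the first and last points turns those partitions into
    non-crossing partitions of [n] points on a circle with the block [A0] of [m]
    marked.  The free cumulants inherit cyclic invariance from [phi], so rotating
    back leaves the weights of the other blocks unchanged, and summing over [m]
    in [A0] rebuilds [Delta_star kappac] on [A0].  Hence [Delta_star kappac]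
    satisfies the identities which determine [kappa']. *)

Require Import Defs.
From mathcomp Require Import all_boot all_order all_algebra.
From mathcomp Require Import boolp reals complex zify.

Set Implicit Arguments.
Unset Strict Implicit.
Unset Printing Implicit Defensive.

(** * Non-crossing partitions *)

Lemma partition_elemP (T : finType) (P : {set {set T}}) (D : {set T}) :
  reflect [/\ {in P, forall A : {set T}, A != set0},
              {in P, forall A : {set T}, A \subset D},
              {in D, forall x, exists2 A, A \in P & x \in A} &
              {in P &, forall (A B : {set T}) x, x \in A -> x \in B -> A = B}]
          (partition P D).
Proof.
apply: (iffP idP) => [partP|[P0 PD DP PI]].
  split=> [A AP|A AP|x xD|A B AP BP x xA xB].
  - exact: partition_neq0 partP AP.
  - exact: partitionS partP AP.
  - exists (pblock P x); last by rewrite mem_pblock (cover_partition partP).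
    by rewrite pblock_mem ?(cover_partition partP).
  - have tP := partition_trivIset partP.
    by rewrite -(def_pblock tP AP xA) (def_pblock tP BP xB).
apply/and3P; split.
- rewrite eqEsubset; apply/andP; split; first by apply/bigcupsP=> A /PD.
  by apply/subsetP=> x /DP[A AP xA]; apply/bigcupP; exists A.
- apply/trivIsetP=> A B AP BP; apply: contraR => /pred0Pn[x /andP[xA xB]].
  exact/eqP/(PI A B AP BP x).
- by apply/negP=> /P0; rewrite eqxx.
Qed.

(* Unlike [a < b < c < d], this condition is invariant under rotations. *)
Definition cyc4 (a b c d : nat) : bool :=
  [|| [&& a < b, b < c & c < d], [&& b < c, c < d & d < a],
      [&& c < d, d < a & a < b] | [&& d < a, a < b & b < c]].

(** The disjuncts of [cyc4] are the four rotations of [a < b < c < d]; an odd rotation exchanges the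
    roles of [A] and [B], which the symmetric conclusion tolerates. *)
Lemma noncrossing_cycP n (P : {set {set 'I_n}}) :
  reflect ({in P &, forall (A B : {set 'I_n}) (a b c d : 'I_n), a \in A -> b \in B ->
              c \in A -> d \in B -> cyc4 a b c d -> A = B})
          (noncrossing P).
Proof.
apply: (iffP idP) => [ncP A B AP BP a b c d aA bB cA dB|ncP].
  have nc A' B' a' b' c' d' : A' \in P -> B' \in P -> a' \in A' -> b' \in B' ->
      c' \in A' -> d' \in B' -> [&& a' < b', b' < c' & c' < d'] -> A' = B'.
    move=> A'P B'P a'A b'B c'A d'B /(implyP _)/eqP; apply.
    move/forall_inP/(_ _ A'P)/forall_inP/(_ _ B'P): ncP.
    move/forall_inP/(_ _ a'A)/forall_inP/(_ _ b'B).
    by move/forall_inP/(_ _ c'A)/forall_inP/(_ _ d'B).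
  case/or4P; first exact: nc.
  - by move=> H; apply/esym; apply: nc H.
  - exact: nc.
  - by move=> H; apply/esym; apply: nc H.
apply/forall_inP=> A AP; apply/forall_inP=> B BP; apply/forall_inP=> a aA.
apply/forall_inP=> b bB; apply/forall_inP=> c cA; apply/forall_inP=> d dB.
apply/implyP=> H; apply/eqP; apply: (ncP A B AP BP a b c d) => //.
by rewrite /cyc4 H.
Qed.

(** Blocks stay subsets of the ambient ['I_n], so partitions of complementary segments can be united
    as plain sets. *)
Definition NC_on n (D : {set 'I_n}) : {set {set {set 'I_n}}} :=
  [set P | partition P D & noncrossing P].

Definition blocks_image m n (f : 'I_m -> 'I_n) (P : {set {set 'I_m}}) :
  {set {set 'I_n}} := [set f @: (A : {set 'I_m}) | A in P].

(** * Transport along injections that preserve the cyclic order *)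

Section Relabelling.
Variables (m n : nat) (f : 'I_m -> 'I_n).
Hypothesis injf : injective f.
Hypothesis cycf :
  forall a b c d : 'I_m, cyc4 (f a) (f b) (f c) (f d) = cyc4 a b c d.

Let injimf : injective (fun A : {set 'I_m} => f @: A) := imset_inj injf.

Lemma noncrossing_image P : noncrossing (blocks_image f P) = noncrossing P.
Proof.
apply/noncrossing_cycP/noncrossing_cycP => nc.
  move=> A B AP BP a b c d aA bB cA dB abcd; apply: injimf.
  by apply: (nc _ _ _ _ (f a) (f b) (f c) (f d)); rewrite ?imset_f ?cycf.
move=> _ _ /imsetP[A AP ->] /imsetP[B BP ->] a' b' c' d' /imsetP[a aA ->].
move=> /imsetP[b bB ->] /imsetP[c cA ->] /imsetP[d dB ->] {a' b' c' d'}.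
by rewrite cycf => /(nc A B AP BP a b c d aA bB cA dB) ->.
Qed.

(** Every block of a partition of [f @: D] lies in the image of [f], so it is recovered from its
    preimage. *)
Lemma NC_on_image (D : {set 'I_m}) :
  NC_on (f @: D) = [set blocks_image f P | P in NC_on D].
Proof.
have memE P : (blocks_image f P \in NC_on (f @: D)) = (P \in NC_on D).
  by rewrite !inE noncrossing_image imset_partition.
apply/setP=> Q; apply/idP/imsetP => [QD|[P PD ->]]; last by rewrite memE.
have eqQ : Q = blocks_image f [set f @^-1: (B : {set 'I_n}) | B in Q].
  rewrite /blocks_image -imset_comp -[LHS]imset_id; apply: eq_in_imset => B BQ /=.
  have /subsetP BD : B \subset f @: D.
    by move: QD; rewrite inE => /andP[/partitionS + _]; apply.
  apply/setP=> x; apply/idP/imsetP=> [xB|[y]]; last by rewrite inE => yB ->.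
  by have /imsetP[y _ xy] := BD x xB; exists y; rewrite ?inE -?xy.
by exists [set f @^-1: (B : {set 'I_n}) | B in Q]; rewrite // -memE -eqQ.
Qed.

Lemma big_blocks_image R (idx : R) (op : Monoid.com_law idx) P F :
  \big[op/idx]_(A in blocks_image f P) F A = \big[op/idx]_(A in P) F (f @: A).
Proof. by rewrite big_imset // => A B _ _; apply: injimf. Qed.

Lemma big_NC_on_image R (idx : R) (op : Monoid.com_law idx) (D : {set 'I_m}) F :
  \big[op/idx]_(Q in NC_on (f @: D)) F Q =
  \big[op/idx]_(P in NC_on D) F (blocks_image f P).
Proof.
by rewrite NC_on_image big_imset // => P Q _ _; apply: (imset_inj injimf).
Qed.

End Relabelling.

Lemma NC_onT n : NC n = NC_on [set: 'I_n]. Proof. by []. Qed.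

Lemma cyc4_homo m n (f : 'I_m -> 'I_n) : {mono f : i j / i < j} ->
  forall a b c d : 'I_m, cyc4 (f a) (f b) (f c) (f d) = cyc4 a b c d.
Proof. by move=> fmono a b c d; rewrite /cyc4 !fmono. Qed.

Lemma mono_ord_inj m n (f : 'I_m -> 'I_n) : 
  {mono f : i j / i < j} -> injective f.
Proof.
move=> fmono i j fij; apply/val_inj => /=.
have := fmono i j; have := fmono j i; rewrite fij !ltnn; lia.
Qed.

(** * Words and their restrictions to blocks *)

Section Words.
Variable T : Type.
Implicit Types x : nat -> T.

(** Letters are indexed by [nat], so one [x] serves words of every length and relabelling needs no
    cast between tuple types. *)
Definition subword x n (A : {set 'I_n}) : seq T := [seq x i | i : 'I_n <- enum A].

Lemma size_subword x n (A : {set 'I_n}) : size (subword x A) = #|A|.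
Proof. by rewrite size_map cardE. Qed.

Lemma subword_full x n : subword x [set: 'I_n] = mkseq x n.
Proof.
by rewrite /subword enum_setT -enumT /mkseq -val_enum_ord -map_comp.
Qed.

(** Both lists are strictly increasing and have the same elements. *)
Lemma enum_mono_image m n (f : 'I_m -> 'I_n) (A : {set 'I_m}) :
  {mono f : i j / i < j} -> enum (f @: A) = map f (enum A).
Proof.
move=> fmono; pose lt k (i j : 'I_k) := i < j.
have srt k (B : {set 'I_k}) : sorted (@lt k) (enum B).
  rewrite /enum_mem; apply: sorted_filter; first by move=> ? ? ?; apply: ltn_trans.
  have := iota_ltn_sorted 0 k.
  by rewrite -val_enum_ord sorted_map -enumT.
apply: (@irr_sorted_eq _ (@lt n)) => //.
- by move=> ? ? ?; apply: ltn_trans.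
- by move=> i; apply: ltnn.
- exact: srt.
- rewrite sorted_map (eq_sorted (e' := @lt m)) ?srt //.
move=> i; rewrite mem_enum; apply/imsetP/mapP => -[j jA ->];
  by exists j; rewrite // ?mem_enum // -mem_enum.
Qed.

Lemma subword_mono x m n (f : 'I_m -> 'I_n) (y : nat -> T)
    (A : {set 'I_m}) :
  {mono f : i j / i < j} -> (forall i : 'I_m, x (f i) = y i) ->
  subword x (f @: A) = subword y A.
Proof.
move=> fmono xy; rewrite /subword enum_mono_image // -map_comp.
by apply: eq_map => i /=.
Qed.

End Words.

(** * Cutting a non-crossing partition after the block of the first point *)

Definition joined n (P : {set {set 'I_n}}) (i j : 'I_n) : bool :=
  [exists A in P, (i \in A) && (j \in A)].

Lemma joinedP n (P : {set {set 'I_n}}) (i j : 'I_n) :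
  reflect (exists2 A, A \in P & i \in A /\ j \in A) (joined P i j).
Proof.
apply: (iffP existsP) => [[A /and3P[AP iA jA]]|[A AP [iA jA]]];
  by exists A; rewrite // AP iA jA.
Qed.

Section Split.
Variable n : nat.
Implicit Types (P : {set {set 'I_n.+1}}) (k : 'I_n.+1).

(** For a partition of all points, this is the last point of the block of [ord0]. *)
Definition last_joined P : 'I_n.+1 := [arg max_(i > ord0 | joined P ord0 i) (i : nat)].
Definition seg_le k : {set 'I_n.+1} := [set i : 'I_n.+1 | i <= k].
Definition seg_gt k : {set 'I_n.+1} := [set i : 'I_n.+1 | k < i].

Lemma last_joinedP P k : partition P setT ->
  reflect (joined P ord0 k /\ forall i, joined P ord0 i -> i <= k)
          (last_joined P == k).
Proof.
move=> partP; have J0 : joined P ord0 ord0.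
  apply/joinedP; case/partition_elemP: partP => _ _ /(_ ord0 (in_setT _)) + _.
  by case=> A0 A0P A00; exists A0.
rewrite /last_joined; case: arg_maxnP => // i Ji maxi.
apply: (iffP eqP) => [<- //|[Jk maxk]].
by apply/val_inj/eqP; rewrite eqn_leq maxk //=; apply: maxi.
Qed.

(** A block with a point [a <= k] and a point [b > k] differs from the block of [ord0] and [k], and
    would cross it at [0 < a < k < b]. *)
Lemma NC_split_blocks P k : P \in NC n.+1 -> last_joined P == k ->
  {in P, forall A : {set _}, (A \subset seg_le k) || (A \subset seg_gt k)}.
Proof.
rewrite inE => /andP[partP /noncrossing_cycP ncP].
case/(last_joinedP _ partP)=> /joinedP[A0 A0P [A00 A0k]] maxk A AP.
have [//|/subsetPn[b bA]] := boolP (A \subset seg_le k); rewrite inE -ltnNge => kb.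
apply/subsetP=> a aA; rewrite inE ltnNge; apply/negP=> ak.
have /partition_elemP[_ _ _ uniqP] := partP.
have neqA : A0 <> A.
  move=> E; suff : b <= k by rewrite leqNgt kb.
  by apply/maxk/joinedP; exists A0 => //; split; rewrite // E.
have a0 : a != ord0 by apply/eqP=> E; apply: neqA (uniqP _ _ A0P AP a _ aA); rewrite E.
have nak : a != k by apply/eqP=> E; apply: neqA (uniqP _ _ A0P AP a _ aA); rewrite E.
apply: neqA (ncP A0 A A0P AP ord0 a k b A00 aA A0k bA _).
by move: a0 nak; rewrite /cyc4 -!val_eqE /=; lia.
Qed.

Lemma NC_sub P (S : {set 'I_n.+1}) : P \in NC n.+1 ->
  {in P, forall A : {set _}, (A \subset S) || [disjoint A & S]} ->
  P ::&: S \in NC_on S.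
Proof.
rewrite !inE => /andP[/partition_elemP[P0 _ Pcov Puniq] /noncrossing_cycP ncP] PS.
apply/andP; split; last first.
  apply/noncrossing_cycP=> A B; rewrite !inE => /andP[AP _] /andP[BP _].
  exact: ncP.
apply/partition_elemP; split=> [A|A|x xS|A B]; rewrite ?inE.
- by case/andP=> /P0.
- by case/andP.
- have [A AP xA] := Pcov x (in_setT x); exists A; rewrite // inE AP.
  by case/orP: (PS A AP) => // /pred0P/(_ x); rewrite /= xA xS.
- by move=> /andP[AP _] /andP[BP _]; apply: Puniq.
Qed.

(** Four points in cyclic order cannot alternate between two complementary segments, so blocks on
    opposite sides do not cross. *)
Lemma NC_on_join k P1 P2 : P1 \in NC_on (seg_le k) -> P2 \in NC_on (seg_gt k) ->
  P1 :|: P2 \in NC n.+1.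
Proof.
rewrite !inE => /andP[/partition_elemP[P01 D1 cov1 uniq1] /noncrossing_cycP nc1].
move=> /andP[/partition_elemP[P02 D2 cov2 uniq2] /noncrossing_cycP nc2].
have le1 A i : A \in P1 -> i \in A -> i <= k.
  by move=> /D1/subsetP/[apply]; rewrite inE.
have gt2 A i : A \in P2 -> i \in A -> k < i.
  by move=> /D2/subsetP/[apply]; rewrite inE.
apply/andP; split.
  apply/partition_elemP; split=> [A|A _|x _|A B].
  - by case/setUP=> [/P01|/P02].
  - exact: subsetT.
  - have [xk|kx] := leqP x k.
      by have [|A AP xA] := cov1 x; rewrite ?inE //; exists A; rewrite // inE AP.
    by have [|A AP xA] := cov2 x; rewrite ?inE //; exists A; rewrite // inE AP orbT.
  - move=> /setUP[AP|AP] /setUP[BP|BP] x xA xB; first exact: (uniq1 A B AP BP x).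
    + by have := le1 A x AP xA; rewrite leqNgt (gt2 B x BP xB).
    + by have := le1 B x BP xB; rewrite leqNgt (gt2 A x AP xA).
    + exact: (uniq2 A B AP BP x).
apply/noncrossing_cycP=> A B /setUP[AP|AP] /setUP[BP|BP] a b c d aA bB cA dB.
- exact: nc1.
- move: (le1 A a AP aA) (le1 A c AP cA) (gt2 B b BP bB) (gt2 B d BP dB).
  rewrite /cyc4; lia.
- move: (le1 B b BP bB) (le1 B d BP dB) (gt2 A a AP aA) (gt2 A c AP cA).
  rewrite /cyc4; lia.
- exact: nc2.
Qed.

Lemma NC_on_disjoint k P1 P2 :
  P1 \in NC_on (seg_le k) -> P2 \in NC_on (seg_gt k) -> [disjoint P1 & P2].
Proof.
rewrite !inE => /andP[/partition_elemP[P01 D1 _ _] _] /andP[/partition_elemP[_ D2 _ _] _].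
apply/pred0P=> A /=; apply/negP=> /andP[AP1 AP2].
have /set0Pn[i iA] := P01 A AP1.
move: (D1 A AP1) (D2 A AP2) => /subsetP/(_ i iA) + /subsetP/(_ i iA).
by rewrite !inE leqNgt => /negP.
Qed.

(** The cut is made after [k = last_joined P]. Union of the two pieces is inverted by selecting the
    blocks contained in each segment; only the left piece carries a condition, which records the
    choice of [k]. *)
Lemma big_NC_split R (idx : R) (op : Monoid.com_law idx) F :
  \big[op/idx]_(P in NC n.+1) F P =
  \big[op/idx]_(k < n.+1)
    \big[op/idx]_(P1 in NC_on (seg_le k) | joined P1 ord0 k)
      \big[op/idx]_(P2 in NC_on (seg_gt k)) F (P1 :|: P2).
Proof.
rewrite (partition_big last_joined predT) //; apply: eq_bigr => k _.
rewrite pair_big.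
have disj (A : {set 'I_n.+1}) : (A \subset seg_gt k) = [disjoint A & seg_le k].
  rewrite disjoints_subset; congr (A \subset pred_of_set _).
  by apply/setP=> i; rewrite !inE ltnNge.
have disj' (A : {set 'I_n.+1}) : (A \subset seg_le k) = [disjoint A & seg_gt k].
  rewrite disjoints_subset; congr (A \subset pred_of_set _).
  by apply/setP=> i; rewrite !inE ltnNge negbK.
rewrite (reindex_onto (fun p => p.1 :|: p.2)
           (fun P => (P ::&: seg_le k, P ::&: seg_gt k))) /=; last first.
  move=> P /andP[PNC Pk]; apply/setP=> A; rewrite !inE -andb_orr.
  by case AP: (A \in P) => //=; apply: (NC_split_blocks PNC Pk).
apply: eq_bigl => -[P1 P2] /=; apply/idP/idP.
  move: (P1 :|: P2) => P; case/andP=> /andP[PNC Pk] /eqP[<- <-].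
  have PS := NC_split_blocks PNC Pk.
  have partP : partition P setT by move: PNC; rewrite inE => /andP[].
  apply/andP; split; last first.
    by apply: NC_sub => // A AP; rewrite -disj' orbC; apply: PS.
  apply/andP; split; first by apply: NC_sub => // A AP; rewrite -disj; apply: PS.
  have /(last_joinedP _ partP)[/joinedP[A AP [A0 Ak]] _] := Pk.
  apply/joinedP; exists A => //; rewrite inE AP /=.
  by case/orP: (PS A AP) => // /subsetP/(_ ord0 A0); rewrite inE.
case/andP=> /andP[P1k J] P2k.
have PNC := NC_on_join P1k P2k.
have partP : partition (P1 :|: P2) setT by move: PNC; rewrite inE => /andP[].
move: P1k P2k; rewrite !inE => /andP[/partition_elemP[P01 D1 _ _] _].
move=> /andP[/partition_elemP[P02 D2 _ _] _].
have dis (A : {set 'I_n.+1}) : A != set0 -> A \subset seg_le k -> A \subset seg_gt k -> False.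
  case/set0Pn=> i iA /subsetP/(_ i iA) + /subsetP/(_ i iA).
  by rewrite !inE leqNgt => /negP.
rewrite -andbA; apply/and3P; split.
- by move: PNC; rewrite inE.
- apply/(last_joinedP _ partP); split.
    by case/joinedP: J => A AP HA; apply/joinedP; exists A; rewrite // inE AP.
  move=> i /joinedP[A /setUP[AP|AP] [A0 Ai]].
    by have /subsetP/(_ i Ai) := D1 A AP; rewrite inE.
  by have /subsetP/(_ _ A0) := D2 A AP; rewrite inE.
- apply/eqP; congr pair; apply/setP=> A; rewrite !inE; apply/andP/idP.
  + by case=> /orP[//|AP] AS; case: (dis A); rewrite ?P02 ?D2.
  + by move=> AP; rewrite AP D1.
  + by case=> /orP[AP AS|//]; case: (dis A); rewrite ?P01 ?D1.
  + by move=> AP; rewrite AP orbT D2.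
Qed.

End Split.

Lemma enum_filter (T : finType) (A : {set T}) : enum A = filter (mem A) (enum T).
Proof. by rewrite enumT. Qed.

(** * Inner and outer blocks *)

Lemma bmin_le n (A : {set 'I_n}) i : i \in A -> bmin A <= i.
Proof.
move=> iA; rewrite /bmin; elim: (index_enum _) (mem_index_enum i) => //= j s IHs.
rewrite inE big_cons => /predU1P[<-|/IHs le_i]; first by rewrite iA geq_minl.
by case: ifP => // _; rewrite geq_min le_i orbT.
Qed.

Lemma bmax_ge n (A : {set 'I_n}) i : i \in A -> i <= bmax A.
Proof. by move=> iA; apply: (leq_bigmax_cond (F := fun i : 'I_n => i : nat)). Qed.

Lemma bmin_mem n (A : {set 'I_n}) : A != set0 -> exists2 i, i \in A & bmin A = i.
Proof.
case/set0Pn=> i0 i0A.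
have [i iA mini] := arg_minnP (fun i : 'I_n => i : nat) i0A; exists i => //.
apply/eqP; rewrite eqn_leq bmin_le //= /bmin.
by elim/big_ind: _ => [|a b|j /mini //]; rewrite ?leq_min ?(ltnW (ltn_ord i)) // => -> ->.
Qed.

Lemma bmax_mem n (A : {set 'I_n}) : A != set0 -> exists2 i, i \in A & bmax A = i.
Proof.
rewrite -card_gt0 => A0.
by have [i iA E] := eq_bigmax_cond (fun i : 'I_n => i : nat) A0; exists i.
Qed.

(** Any two points of one block that surround [A] replace the extrema; nonemptiness ensures that
    [bmin A] and [bmax A] are attained and are not the defaults [n] and [0]. *)
Lemma innerP n (P : {set {set 'I_n}}) (A : {set 'I_n}) : A != set0 ->
  reflect (exists2 B, B \in P & exists b d, [/\ b \in B, d \in B &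
             {in A, forall a : 'I_n, b < a < d}])
          (inner P A).
Proof.
move=> A0; apply: (iffP existsP) => [[B /and4P[BP mB _ MB]]|[B BP [b [d [bB dB H]]]]].
  have B0 : B != set0.
    by apply/eqP=> E; move: MB; rewrite /bmax E big_set0.
  have [b bB bE] := bmin_mem B0; have [d dB dE] := bmax_mem B0.
  exists B => //; exists b, d; split=> // a aA.
  have := bmin_le aA; have := bmax_ge aA; rewrite -bE -dE; lia.
have [a aA aE] := bmin_mem A0; have [c cA cE] := bmax_mem A0.
exists B; rewrite BP aE cE /=.
have := bmin_le bB; have := bmax_ge dB; have := H a aA; have := H c cA.
have := bmax_ge aA; rewrite cE; lia.
Qed.

Lemma inner_mono_image m n (f : 'I_m -> 'I_n) P (A : {set 'I_m}) :
  {mono f : i j / i < j} -> A != set0 ->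
  inner (blocks_image f P) (f @: A) = inner P A.
Proof.
move=> fmono A0; have fA0 : f @: A != set0 by rewrite imset_eq0.
apply/(innerP _ fA0)/(innerP _ A0) => -[B BP [b [d [bB dB H]]]].
  move: BP bB dB => /imsetP[C CP ->] /imsetP[b' b'C eb] /imsetP[d' d'C ed].
  exists C => //; exists b', d'; split=> // a aA.
  by have := H (f a) (imset_f f aA); rewrite eb ed !fmono.
exists (f @: B); first exact: imset_f.
exists (f b), (f d); split; rewrite ?imset_f // => _ /imsetP[a aA ->].
by rewrite !fmono H.
Qed.

Section SplitInner.
Variables (n : nat) (k : 'I_n.+1) (P1 P2 : {set {set 'I_n.+1}}).
Hypotheses (P1k : P1 \in NC_on (seg_le k)) (P2k : P2 \in NC_on (seg_gt k)).

(** Every other block of [P1] lies strictly between [ord0] and [k], which share a block; conversely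
    nothing precedes [ord0]. *)
Lemma inner_join_le A : joined P1 ord0 k -> A \in P1 ->
  inner (P1 :|: P2) A = (ord0 \notin A).
Proof.
move=> /joinedP[A0 A0P [A00 A0k]] AP; move: (P1k).
rewrite inE => /andP[/partition_elemP[P0 D1 _ uniq1] _].
apply/(innerP _ (P0 A AP))/idP => [[B _ [b [d [_ _ H]]]]|A'0].
  by apply/negP=> /H.
exists A0; first by rewrite inE A0P.
exists ord0, k; split=> // a aA; rewrite lt0n.
have ak : a <= k by have /subsetP/(_ a aA) := D1 A AP; rewrite inE.
rewrite ltn_neqAle ak andbT; apply/andP; split; apply: contraNneq A'0 => E.
  by rewrite -[ord0](_ : a = _) //; apply/val_inj.
by rewrite -(uniq1 A0 A A0P AP k A0k) // -(_ : a = k) //; apply/val_inj.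
Qed.

(** A block of [P1] ends at [k] at the latest, so it cannot surround a block lying after [k]. *)
Lemma inner_join_gt A : A \in P2 -> inner (P1 :|: P2) A = inner P2 A.
Proof.
move=> AP; move: (P1k) (P2k).
rewrite !inE => /andP[/partition_elemP[_ D1 _ _] _].
move=> /andP[/partition_elemP[P0 D2 _ _] _].
have /set0Pn[a aA] := P0 A AP.
have ka : k < a by have /subsetP/(_ a aA) := D2 A AP; rewrite inE.
apply/(innerP _ (P0 A AP))/(innerP _ (P0 A AP)) => -[B BP [b [d [bB dB H]]]];
  exists B; rewrite ?inE ?BP ?orbT //; try by exists b, d.
case/setUP: BP => // BP; have /subsetP/(_ d dB) := D1 B BP.
by rewrite inE => dk; have := H a aA; lia.
Qed.

End SplitInner.

(** * Gluing the first and last points *)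

Section Collapse.
Variable n : nat.

(** Reduction modulo [n.+1] sends the last point to [0] and fixes all others. *)
Definition collapse (i : 'I_n.+2) : 'I_n.+1 := inord (i %% n.+1).
Definition uncollapse (i : 'I_n.+1) : 'I_n.+2 := widen_ord (leqnSn _) i.

Lemma collapseE (i : 'I_n.+2) :
  collapse i = (if i == n.+1 :> nat then 0 else i) :> nat.
Proof.
rewrite inordK ?ltn_mod //; case: eqP => [->|]; first by rewrite modnn.
by move=> ?; rewrite modn_small //; have := ltn_ord i; lia.
Qed.

Lemma uncollapseK : cancel uncollapse collapse.
Proof.
move=> i; apply/val_inj; rewrite /= collapseE /= ltn_eqF //.
Qed.

Lemma collapse_max : collapse ord_max = ord0.
Proof. by apply/val_inj; rewrite /= collapseE eqxx. Qed.

Lemma collapse_uncollapse i : i != ord_max -> uncollapse (collapse i) = i.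
Proof.
move=> ni; apply/val_inj; rewrite /= collapseE ifN //.
Qed.

Lemma uncollapse0 : uncollapse ord0 = ord0. Proof. exact: val_inj. Qed.

Definition expand_blocks (P : {set {set 'I_n.+1}}) : {set {set 'I_n.+2}} :=
  [set collapse @^-1: (A : {set 'I_n.+1}) | A in P].

Lemma imset_preim_collapse (A : {set 'I_n.+1}) : collapse @: (collapse @^-1: A) = A.
Proof.
apply/setP=> i; apply/imsetP/idP => [[j]|iA]; first by rewrite inE => jA ->.
by exists (uncollapse i); rewrite ?inE uncollapseK.
Qed.

Lemma preim_collapse_inj : injective (fun A : {set 'I_n.+1} => collapse @^-1: A).
Proof.
by move=> A B AB; rewrite -[A]imset_preim_collapse AB imset_preim_collapse.
Qed.

(** The glued points are neighbours on the circle: if both occur among the four points they are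
    cyclically consecutive there, and otherwise the cyclic order survives. *)
Lemma cyc4_collapse (a b c d : 'I_n.+2) : cyc4 a b c d ->
  [|| cyc4 (collapse a) (collapse b) (collapse c) (collapse d),
      collapse a == collapse b, collapse b == collapse c,
      collapse c == collapse d | collapse d == collapse a].
Proof.
have := ltn_ord a; have := ltn_ord b; have := ltn_ord c; have := ltn_ord d.
rewrite -!val_eqE /= !collapseE /cyc4.
by do 4![case: eqP => ?]; lia.
Qed.

(** By [cyc4_collapse], a crossing upstairs gives either a crossing in [P] or a point common to [A]
    and [B]; both force [A = B]. *)
Lemma expand_NC P : P \in NC n.+1 ->
  expand_blocks P \in NC n.+2 /\ joined (expand_blocks P) ord0 ord_max.
Proof.
rewrite inE => /andP[/partition_elemP[P0 _ cov uniqP] /noncrossing_cycP ncP].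
split; last first.
  have [A AP A0] := cov ord0 (in_setT _); apply/joinedP.
  exists (collapse @^-1: A); first exact: imset_f.
  by rewrite !inE collapse_max -uncollapse0 uncollapseK.
rewrite inE; apply/andP; split.
  apply/partition_elemP; split.
  - move=> _ /imsetP[A /P0 /set0Pn[i iA] ->]; apply/set0Pn; exists (uncollapse i).
    by rewrite inE uncollapseK.
  - by move=> A _; apply: subsetT.
  - move=> i _; have [A AP iA] := cov (collapse i) (in_setT _).
    by exists (collapse @^-1: A); [exact: imset_f | rewrite inE].
  - move=> _ _ /imsetP[A AP ->] /imsetP[B BP ->] x; rewrite !inE => xA xB.
    by rewrite (uniqP A B AP BP _ xA xB).
apply/noncrossing_cycP => _ _ /imsetP[A AP ->] /imsetP[B BP ->] a b c d.
rewrite !inE => aA bB cA dB /cyc4_collapse abcd; suff -> : A = B by [].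
case/or4P: abcd => [|/eqP E|/eqP E|/orP[]/eqP E].
- exact: (ncP A B AP BP _ _ _ _ aA bB cA dB).
- by apply: (uniqP A B AP BP (collapse a)); rewrite // E.
- by apply: (uniqP A B AP BP (collapse c)); rewrite // -E.
- by apply: (uniqP A B AP BP (collapse c)); rewrite // E.
- by apply: (uniqP A B AP BP (collapse a)); rewrite // -E.
Qed.

Definition collapse_blocks (Q : {set {set 'I_n.+2}}) : {set {set 'I_n.+1}} :=
  [set collapse @: (B : {set 'I_n.+2}) | B in Q].

Lemma expand_blocksK : cancel expand_blocks collapse_blocks.
Proof.
move=> P; rewrite /collapse_blocks /expand_blocks -imset_comp.
by rewrite (eq_imset _ (g := id)) ?imset_id // => A /=; rewrite imset_preim_collapse.
Qed.

(** The only fibre of [collapse] with two points is formed by [ord0] and [ord_max]. Since these are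
    joined, every block is a union of fibres. *)
Lemma collapse_blocksK Q : Q \in NC n.+2 -> joined Q ord0 ord_max ->
  expand_blocks (collapse_blocks Q) = Q.
Proof.
rewrite inE => /andP[/partition_elemP[_ _ _ uniqQ] _] /joinedP[B0 B0Q [B00 B0m]].
rewrite /collapse_blocks /expand_blocks -imset_comp -[RHS]imset_id.
apply: eq_in_imset => B BQ /=; apply/setP=> i; rewrite inE.
apply/imsetP/idP => [[j jB E]|iB]; last by exists i.
have [ei|ni] := eqVneq i ord_max; have [ej|nj] := eqVneq j ord_max.
- by rewrite ei -ej.
- rewrite ei (uniqQ B B0 BQ B0Q ord0) //.
  by rewrite -uncollapse0 -collapse_max -ei E collapse_uncollapse.
- rewrite -(collapse_uncollapse ni) E ej collapse_max uncollapse0.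
  by rewrite (uniqQ B B0 BQ B0Q ord_max) // -ej.
- by rewrite -(collapse_uncollapse ni) E collapse_uncollapse.
Qed.

Lemma collapse_NC P : expand_blocks P \in NC n.+2 -> P \in NC n.+1.
Proof.
rewrite !inE => /andP[/partition_elemP[Q0 _ cov uniqQ] /noncrossing_cycP ncQ].
have memE A : A \in P -> collapse @^-1: A \in expand_blocks P by apply: imset_f.
apply/andP; split.
  apply/partition_elemP; split.
  - move=> A /memE AP; have /set0Pn[j] := Q0 _ AP; rewrite inE => jA; apply/set0Pn.
    by exists (collapse j).
  - by move=> A _; apply: subsetT.
  - move=> i _; have [_ /imsetP[A AP ->]] := cov (uncollapse i) (in_setT _).
    by rewrite inE uncollapseK => iA; exists A.
  - move=> A B /memE AP /memE BP i iA iB; apply: preim_collapse_inj.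
    by apply: (uniqQ _ _ AP BP (uncollapse i)); rewrite inE uncollapseK.
apply/noncrossing_cycP=> A B /memE AP /memE BP a b c d aA bB cA dB abcd.
apply: preim_collapse_inj; apply: (ncQ _ _ AP BP (uncollapse a) (uncollapse b)
  (uncollapse c) (uncollapse d)) => //; by rewrite inE uncollapseK.
Qed.

Lemma big_NC_joined R (idx : R) (op : Monoid.com_law idx) F :
  \big[op/idx]_(Q in NC n.+2 | joined Q ord0 ord_max) F Q =
  \big[op/idx]_(P in NC n.+1) F (expand_blocks P).
Proof.
rewrite (reindex_onto expand_blocks collapse_blocks) /=; last first.
  by move=> Q /andP[]; apply: collapse_blocksK.
apply: eq_bigl => P; rewrite expand_blocksK eqxx andbT.
by apply/andP/idP => [[/collapse_NC]|/expand_NC].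
Qed.

Lemma big_expand_blocks R (idx : R) (op : Monoid.com_law idx) P F :
  \big[op/idx]_(B in expand_blocks P) F B =
  \big[op/idx]_(A in P) F (collapse @^-1: A).
Proof. by rewrite big_imset // => A B _ _; apply: preim_collapse_inj. Qed.

(** The extra point over [ord0] is the largest one, hence comes last. *)
Lemma enum_preim_collapse (A : {set 'I_n.+1}) :
  enum (collapse @^-1: A) =
  map uncollapse (enum A) ++ (if ord0 \in A then [:: ord_max] else [::]).
Proof.
rewrite !enum_filter enum_ordSr filter_rcons filter_map.
rewrite (_ : mem _ ord_max = (ord0 \in A)); last by rewrite /= inE collapse_max.
rewrite (eq_filter (a2 := mem A)); first by case: ifP; rewrite ?cats1 ?cats0.
by move=> i; rewrite /= inE uncollapseK.
Qed.

End Collapse.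

(** * Rotations of the points on a circle *)

Section Rotation.
Variables (n m : nat).
Hypothesis mn : m <= n.+1.

Definition rot_ord (i : 'I_n.+1) : 'I_n.+1 := inord ((i + m) %% n.+1).

Lemma rot_ordE i :
  rot_ord i = (if i + m < n.+1 then i + m else i + m - n.+1) :> nat.
Proof.
rewrite inordK ?ltn_mod //; case: ltnP => [/modn_small//|le].
by rewrite -{1}(subnK le) modnDr modn_small //; have := ltn_ord i; lia.
Qed.

Lemma rot_ord_inj : injective rot_ord.
Proof.
move=> i j /(congr1 val) /=; rewrite !rot_ordE => E; apply/val_inj => /=.
by have := ltn_ord i; have := ltn_ord j; move: E; do 2!case: ifP; lia.
Qed.

Lemma cyc4_rot_ord a b c d :
  cyc4 (rot_ord a) (rot_ord b) (rot_ord c) (rot_ord d) = cyc4 a b c d.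
Proof.
have := ltn_ord a; have := ltn_ord b; have := ltn_ord c; have := ltn_ord d.
rewrite !rot_ordE /cyc4.
by do 4![case: ifP => ?]; lia.
Qed.

Lemma imset_rot_ordT : rot_ord @: [set: 'I_n.+1] = [set: 'I_n.+1].
Proof.
by apply/eqP; rewrite eqEcard subsetT (card_imset _ rot_ord_inj) leqnn.
Qed.

Lemma map_rot_ord : map rot_ord (enum 'I_n.+1) = rot m (enum 'I_n.+1).
Proof.
apply: (eq_from_nth (x0 := ord0)) => [|i]; first by rewrite size_rot size_map.
rewrite size_map size_enum_ord => ilt; apply/val_inj.
rewrite (nth_map ord0) ?size_enum_ord //= rot_ordE nth_enum_ord //.
rewrite /rot nth_cat size_drop size_enum_ord.
case: ltnP => h; case: ltnP => h'; try lia.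
  by rewrite nth_drop nth_enum_ord; lia.
by rewrite nth_take ?nth_enum_ord; lia.
Qed.

(** Filtering a rotated list rotates the filtered list, by the number of selected elements among the
    first [m]. *)
Lemma enum_rot_ord (A : {set 'I_n.+1}) :
  exists j, map rot_ord (enum A) = rot j (enum (rot_ord @: A)).
Proof.
have -> : map rot_ord (enum A) = filter (mem (rot_ord @: A)) (rot m (enum 'I_n.+1)).
  rewrite -map_rot_ord filter_map; congr map; rewrite enum_filter.
  by apply: eq_filter => i /=; rewrite (mem_imset _ _ rot_ord_inj).
exists (size (filter (mem (rot_ord @: A)) (take m (enum 'I_n.+1)))).
rewrite enum_filter; move: (enum 'I_n.+1) => e.
by rewrite -{3}(cat_take_drop m e) !filter_cat rot_size_cat.
Qed.

End Rotation.

(** Without repetitions, a rotation is determined by its first element. *)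
Lemma rot_to_index (T : eqType) (s : seq T) j x t :
  uniq s -> rot j s = x :: t -> rot j s = rot (index x s) s.
Proof.
move=> us E; have [le|lt] := leqP (size s) j.
  by move: E; rewrite rot_oversize // => ->; rewrite /= eqxx rot0.
congr (rot _ s); have : nth x (rot j s) 0 = x by rewrite E.
rewrite /rot nth_cat size_drop subn_gt0 lt nth_drop addn0 => <-.
by rewrite index_uniq.
Qed.

Import GRing.Theory.
Local Open Scope ring_scope.

(** * Moment-cumulant sums *)

Lemma NC0_eq0 (P : {set {set 'I_0}}) : P \in NC 0 -> P = set0.
Proof.
rewrite inE => /andP[partP _]; apply/eqP; rewrite -partition_set0.
by rewrite (_ : set0 = setT) //; apply/setP=> -[].
Qed.

Lemma setT_NC n : [set [set: 'I_n.+1]] \in NC n.+1.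
Proof.
rewrite inE; apply/andP; split.
  apply/partition_elemP; split=> [A|A _|i _|A B]; rewrite ?inE ?subsetT //.
  - by move/eqP->; apply/set0Pn; exists ord0; rewrite inE.
  - by exists setT; rewrite inE.
  - by move/eqP-> => /eqP->.
by apply/noncrossing_cycP=> A B /set1P-> /set1P->.
Qed.

(** This bound drives the inductions on word length: outside the one-block partition all subwords
    are shorter. *)
Lemma NC_block_lt n P (A : {set 'I_n}) :
  P \in NC n -> P != [set [set: 'I_n]] -> A \in P -> (#|A| < n)%N.
Proof.
rewrite inE => /andP[/partition_elemP[P0 _ _ uniqP] _] PT AP.
rewrite -[ltnRHS]card_ord -cardsT; apply/proper_card; rewrite properT.
apply: contraNneq PT => AT; apply/eqP/setP=> B; rewrite inE.
apply/idP/eqP=> [BP|->]; last by rewrite -AT.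
have /set0Pn[j jB] := P0 B BP; rewrite -AT.
by apply: (uniqP B A BP AP j); rewrite // AT inE.
Qed.

Lemma NC_card_gt0 n P (A : {set 'I_n}) : P \in NC n -> A \in P -> (0 < #|A|)%N.
Proof.
by rewrite inE card_gt0 => /andP[/partition_elemP[P0 _ _ _] _] /P0.
Qed.

(** * The recursion for c-free moment sums *)

Section Cumulants.
Variables (K : comPzRingType) (T : Type).
Implicit Types (c cc : seq T -> K) (x : nat -> T).

(** The c-free moment formula with arbitrary weights; [c = 0] gives the Boolean one. *)
Definition cfree_sum c cc n x : K :=
  \sum_(P in NC n) \prod_(A in P)
    if inner P A then c (subword x A) else cc (subword x A).

(** There are [n.+1] points here; with the first and last joined, the block of [ord0] is the only
    outer one. *)
Definition outer_sum c cc n x : K :=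
  \sum_(P in NC n.+1 | joined P ord0 ord_max) \prod_(A in P)
    if ord0 \in A then cc (subword x A) else c (subword x A).

(** The empty partition contributes an empty product. This value enters the recursion at [k = n],
    where nothing remains on the right. *)
Lemma cfree_sum0 c cc x : cfree_sum c cc 0 x = 1.
Proof.
rewrite /cfree_sum (big_pred1 set0) ?big_set0 // => P /=.
apply/idP/eqP => [/NC0_eq0//|->]; rewrite inE; apply/andP; split.
  by apply/partition_elemP; split=> [A|A|[]|A B]; rewrite ?inE.
by apply/noncrossing_cycP=> A B; rewrite inE.
Qed.

(** After the cut, the block of the first point is the only outer block on the left, and innerness
    on the right depends on the right piece alone. The summand therefore factors. *)
Lemma cfree_sum_rec c cc n x :
  cfree_sum c cc n.+1 x =
  \sum_(k < n.+1)
    outer_sum c cc k x * cfree_sum c cc (n - k) (fun i => x (k.+1 + i)%N).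
Proof.
rewrite /cfree_sum big_NC_split; apply: eq_bigr => k _.
have kn : (k.+1 <= n.+1)%N := ltn_ord k.
(* Increasing parametrisations of the two segments; the right one starts at [k.+1]. *)
pose f1 : 'I_k.+1 -> 'I_n.+1 := widen_ord kn.
pose f2 (i : 'I_(n - k)) : 'I_n.+1 := inord (k.+1 + i).
have f2E i : f2 i = (k.+1 + i)%N :> nat.
  by rewrite inordK //; have := ltn_ord i; lia.
have f1mono : {mono f1 : i j / (i < j)%N} by [].
have f2mono : {mono f2 : i j / (i < j)%N} by move=> i j; rewrite !f2E; lia.
have f1T : seg_le k = f1 @: setT.
  apply/setP=> i; rewrite inE; apply/idP/imsetP=> [ik|[j _ ->]].
    by exists (Ordinal (ik : (i < k.+1)%N)) => //; apply: val_inj.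
  by rewrite -ltnS /= ltn_ord.
have f2T : seg_gt k = f2 @: setT.
  apply/setP=> i; rewrite inE; apply/idP/imsetP=> [ki|[j _ ->]].
    have h : (i - k.+1 < n - k)%N by have := ltn_ord i; lia.
    by exists (Ordinal h) => //; apply/val_inj; rewrite /= f2E /=; lia.
  by rewrite f2E; lia.
pose w1 (A : {set 'I_n.+1}) := if ord0 \in A then cc (subword x A) else c (subword x A).
pose w2 (P : {set {set 'I_n.+1}}) A :=
  if inner P A then c (subword x A) else cc (subword x A).
transitivity ((\sum_(P1 in NC_on (seg_le k) | joined P1 ord0 k) \prod_(A in P1) w1 A) *
   (\sum_(P2 in NC_on (seg_gt k)) \prod_(A in P2) w2 P2 A)).
  rewrite big_distrlr; apply: eq_bigr => P1 /andP[P1k J]; apply: eq_bigr => P2 P2k.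
  rewrite (eq_bigl [predU P1 & P2]) => [|A]; last by rewrite !inE.
  rewrite bigU /=; last exact: NC_on_disjoint P1k P2k.
  congr (_ * _); apply: eq_bigr => A AP.
    by rewrite (inner_join_le _ P1k) // /w1; case: (ord0 \in A).
  by rewrite (inner_join_gt P1k P2k).
congr (_ * _).
  rewrite f1T big_mkcondr (big_NC_on_image (mono_ord_inj f1mono) (cyc4_homo f1mono)).
  rewrite -NC_onT /outer_sum -big_mkcondr /=.
  have f10 : f1 ord0 = ord0 by apply: val_inj.
  have f1k : f1 ord_max = k by apply: val_inj.
  have in0 (A : {set 'I_k.+1}) : (ord0 \in f1 @: A) = (ord0 \in A).
    by rewrite -(mem_imset _ _ (mono_ord_inj f1mono)) f10.
  have ink (A : {set 'I_k.+1}) : (k \in f1 @: A) = (ord_max \in A).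
    by rewrite -(mem_imset _ _ (mono_ord_inj f1mono)) f1k.
  apply: eq_big => [P|P _].
    congr (_ && _); apply/joinedP/joinedP => [[_ /imsetP[A AP ->]]|[A AP]].
      by rewrite in0 ink; exists A.
    by exists (f1 @: A); rewrite ?imset_f // in0 ink.
  rewrite (big_blocks_image (mono_ord_inj f1mono)).
  by apply: eq_bigr => A _; rewrite /w1 in0 (subword_mono (y := x)).
rewrite f2T (big_NC_on_image (mono_ord_inj f2mono) (cyc4_homo f2mono)).
rewrite -NC_onT; apply: eq_bigr => P PNC.
rewrite (big_blocks_image (mono_ord_inj f2mono)).
apply: eq_bigr => A AP; rewrite /w2 inner_mono_image // -?card_gt0; last exact: NC_card_gt0 AP.
by rewrite (subword_mono (y := fun i => x (k.+1 + i)%N)) // => i; rewrite f2E.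
Qed.

(* The last term of [cfree_sum_rec] is [outer_sum] itself, so the latter is
   determined by the moments. *)
Lemma outer_sum_inj c1 cc1 c2 cc2 :
  (forall n x, (0 < n)%N -> cfree_sum c1 cc1 n x = cfree_sum c2 cc2 n x) ->
  forall n x, outer_sum c1 cc1 n x = outer_sum c2 cc2 n x.
Proof.
move=> eqs; have eqs' n x : cfree_sum c1 cc1 n x = cfree_sum c2 cc2 n x.
  by case: n => [|n]; [rewrite !cfree_sum0 | apply: eqs].
move=> n; have [m] := ubnP n; elim: m n => // m IHm n lenm x.
have := eqs' n.+1 x; rewrite !cfree_sum_rec !big_ord_recr /= subnn !cfree_sum0 !mulr1.
rewrite (eq_bigr (fun k : 'I_n => outer_sum c2 cc2 k x *
  cfree_sum c2 cc2 (n - k) (fun i => x (k.+1 + i)%N))) => [|k _].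
  exact: addrI.
by rewrite eqs' IHm //; apply: leq_trans (ltn_ord k) _.
Qed.

Lemma big_NC_full n (F : {set {set 'I_n.+1}} -> K) :
  \sum_(P in NC n.+1) F P = F [set setT] +
    \sum_(P in NC n.+1 | P != [set setT]) F P.
Proof. by rewrite (bigD1 [set setT]) ?setT_NC. Qed.

(** If the block of [ord0] is not everything, some other block misses [ord0] and carries weight
    zero. *)
Lemma outer_sum_boolean cc n x :
  outer_sum (fun=> 0) cc n x = cc (mkseq x n.+1).
Proof.
rewrite /outer_sum (bigD1 [set setT]) /=; last first.
  rewrite setT_NC; apply/joinedP; exists setT; rewrite !inE //.
rewrite big_set1 inE subword_full big1 ?addr0 // => P /andP[/andP[PNC J] PT].
case/joinedP: J => A AP [A0 _].
have [i _ iA] : exists2 i, i \in [set: 'I_n.+1] & i \notin A.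
  apply/subsetPn; apply/negP=> /subset_leq_card.
  by rewrite cardsT card_ord leqNgt (NC_block_lt PNC PT AP).
move: PNC; rewrite inE => /andP[/partition_elemP[_ _ cov uniqP] _].
have [B BP iB] := cov i (in_setT _).
have B0 : ord0 \notin B.
  by apply: contra iA => B0; rewrite (uniqP A B AP BP ord0).
by rewrite (bigD1 B) //= (negPf B0) mul0r.
Qed.


End Cumulants.

(** A block surrounding another one is not an interval. Conversely, a block through a gap of [A] is
    trapped in that gap by the non-crossing condition, hence inner. *)
Lemma Int_NC n (P : {set {set 'I_n}}) : P \in NC n ->
  (P \in Int n) = [forall A in P, ~~ inner P A].
Proof.
move=> PNC; rewrite inE PNC /=; move: PNC; rewrite inE.
case/andP=> /partition_elemP[P0 _ cov uniqP] /noncrossing_cycP ncP.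
apply/forall_inP/forall_inP => H A AP.
  apply/negP=> /(innerP _ (P0 A AP))[B BP [b [d [bB dB Hbd]]]].
  have /set0Pn[a aA] := P0 A AP.
  have aB : a \in B.
    move/forall_inP/(_ _ bB)/forall_inP/(_ _ dB)/forallP/(_ a): (H B BP).
    by rewrite Hbd.
  by have := Hbd b; rewrite (uniqP A B AP BP a aA aB) bB ltnn => /(_ isT).
apply/forall_inP=> a aA; apply/forall_inP=> c cA; apply/forallP=> b.
apply/implyP=> /andP[ab bc]; apply: contraT => bA.
have [B BP bB] := cov b (in_setT _); move: (H B BP).
have neqAB : A <> B by move=> E; rewrite E bB in bA.
suff -> : inner P B by [].
apply/(innerP _ (P0 B BP)); exists A => //; exists a, c; split=> // d dB.
have na : d != a by apply/eqP=> E; apply: neqAB (uniqP A B AP BP d _ dB); rewrite E.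
have nc : d != c by apply/eqP=> E; apply: neqAB (uniqP A B AP BP d _ dB); rewrite E.
have [|ad] := leqP d a => [da|].
  have : cyc4 a b c d by move: na; rewrite /cyc4 -val_eqE /=; lia.
  by move/(ncP A B AP BP _ _ _ _ aA bB cA dB)/neqAB.
rewrite /=; have [//|] := ltnP d c => cd.
have : cyc4 a b c d by move: nc; rewrite /cyc4 -val_eqE /=; lia.
by move/(ncP A B AP BP _ _ _ _ aA bB cA dB)/neqAB.
Qed.

Definition shift (T : Type) (x : nat -> T) n m : nat -> T :=
  fun i => x ((i + m) %% n)%N.

Lemma mkseq_shift (T : Type) (x : nat -> T) n m : (m <= n)%N ->
  mkseq (shift x n m) n = rot m (mkseq x n).
Proof.
case: n => [|n] mn; first by rewrite /mkseq /= rot_oversize.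
have E := map_rot_ord mn.
rewrite -!subword_full /subword !enum_setT -!enumT -map_rot -E -map_comp.
by apply: eq_map => i /=; rewrite /shift inordK // ltn_mod.
Qed.

Lemma subword_rot_ord (T : Type) (x : nat -> T) n m (A : {set 'I_n.+1}) :
  subword (shift x n.+1 m) A =
  map (fun i : 'I_n.+1 => x i) (map (rot_ord m) (enum A)).
Proof.
rewrite /subword -map_comp; apply: eq_map => i /=.
by rewrite /shift inordK // ltn_mod.
Qed.

(** * Cumulants as functions of words *)

Section Ev.
Variables (K : fieldType) (V : lmodType K).
Implicit Types (phi chi beta kappa kappac : mfamily V) (s : seq V) (x : nat -> V).

(* [phi] as a function of words, which avoids casts between tuple sizes *)
Definition ev phi s : K := phi (size s) (in_tuple s).

Lemma evE phi n (x : n.-tuple V) : phi n x = ev phi x.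
Proof.
case: x => s szs; rewrite /ev /=; have eqn : size s = n := eqP szs.
by case: n / eqn szs => szs; congr (phi _ _); apply: val_inj.
Qed.

Lemma ev_restr phi n x (A : {set 'I_n}) :
  phi #|A| (restr (mktuple (fun i : 'I_n => x i)) A) = ev phi (subword x A).
Proof.
rewrite evE; congr (ev phi _); apply: eq_map => i.
exact: tnth_mktuple.
Qed.

Lemma ev_mkseq phi n x :
  ev phi (mkseq x n) = phi n (mktuple (fun i : 'I_n => x i)).
Proof.
by rewrite evE -subword_full /subword enum_setT -enumT.
Qed.

Lemma ev_rot_tracial phi : tracial phi ->
  forall m s, ev phi (rot m s) = ev phi s.
Proof.
move=> tr m s; have [le|/ltnW] := leqP (size s) m; first by rewrite rot_oversize.
elim: m => [|m IHm] lt; first by rewrite rot0.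
rewrite -(IHm (ltnW lt)) rotS //.
have : size (rot m s) = size s by rewrite size_rot.
(* Traciality starts at length 2; shorter words are fixed by rotation. *)
move: (rot m s) => t szt; have [t1|t2] := leqP (size t) 1.
  by rewrite rot_oversize.
by have := tr _ t2 (in_tuple t); rewrite !evE.
Qed.

Lemma ev_free phi kappa n x : free_cumulants phi kappa -> (0 < n)%N ->
  ev phi (mkseq x n) = \sum_(P in NC n) \prod_(A in P) ev kappa (subword x A).
Proof.
move=> h n0; rewrite ev_mkseq h //.
by apply: eq_bigr => P _; apply: eq_bigr => A _; rewrite ev_restr.
Qed.

Lemma ev_cfree chi kappa kappac n x :
  cfree_cumulants chi kappa kappac -> (0 < n)%N ->
  ev chi (mkseq x n) = cfree_sum (ev kappa) (ev kappac) n x.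
Proof.
move=> h n0; rewrite ev_mkseq h //; apply: eq_bigr => P _.
rewrite [RHS](bigID (inner P)) /=; congr (_ * _); apply: eq_bigr => A /andP[_].
  by move=> ->; rewrite ev_restr.
by move=> /negPf->; rewrite ev_restr.
Qed.

(** Zero weight on inner blocks leaves the partitions without inner blocks, which are the interval
    ones by [Int_NC]. *)
Lemma ev_boolean chi beta n x : boolean_cumulants chi beta -> (0 < n)%N ->
  ev chi (mkseq x n) = cfree_sum (fun=> 0) (ev beta) n x.
Proof.
move=> h n0; rewrite ev_mkseq h // [RHS](bigID (mem (Int n))) /=.
rewrite [X in _ + X]big1 ?addr0 => [|P /andP[PNC]]; last first.
  rewrite (Int_NC PNC) => /forall_inPn[A AP]; rewrite negbK => iA.
  by rewrite (bigD1 A) //= iA mul0r.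
apply: eq_big => [P|P PI].
  by apply/idP/andP => [PI|[]//]; split=> //; case/setIdP: PI.
apply: eq_bigr => A AP; rewrite ev_restr ifN //.
have PNC : P \in NC n by case/setIdP: PI.
by move: PI; rewrite (Int_NC PNC) => /forall_inP; apply.
Qed.

Lemma ev_inf_free phi' kappa kappa' n x :
  inf_free_cumulants phi' kappa kappa' -> (0 < n)%N ->
  ev phi' (mkseq x n) =
  \sum_(P in NC n) \sum_(A0 in P) ev kappa' (subword x A0) *
      \prod_(A in P | A != A0) ev kappa (subword x A).
Proof.
move=> h n0; rewrite ev_mkseq h //.
apply: eq_bigr => P _; apply: eq_bigr => A0 _; rewrite ev_restr; congr (_ * _).
by apply: eq_bigr => A _; rewrite ev_restr.
Qed.

(** Both moment formulas compute [chi], so their outer sums agree; for zero inner weights the outer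
    sum is a single value of [beta]. *)
Lemma boolean_outer_sum chi beta kappa kappac n x :
  boolean_cumulants chi beta -> cfree_cumulants chi kappa kappac ->
  ev beta (mkseq x n.+1) = outer_sum (ev kappa) (ev kappac) n x.
Proof.
move=> hb hc; rewrite -(outer_sum_boolean (ev beta)).
by apply: outer_sum_inj => {}n {}x n0; rewrite -(ev_boolean _ hb) // -(ev_cfree _ hc).
Qed.

Lemma big_NC_rot n m (F : {set {set 'I_n.+1}} -> K) : (m <= n.+1)%N ->
  \sum_(P in NC n.+1) F P =
  \sum_(P in NC n.+1) F (blocks_image (@rot_ord n m) P).
Proof.
move=> mn; rewrite [in LHS]NC_onT -[in LHS](imset_rot_ordT mn).
by rewrite (big_NC_on_image (rot_ord_inj mn) (cyc4_rot_ord mn)).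
Qed.

(** Induction on the length. Rotation permutes the non-crossing partitions and rotates the subword
    on each block; the proper blocks are settled by induction, so equality of moments leaves
    equality of the full-block terms. *)
Lemma ev_rot_cumulant phi kappa : tracial phi -> free_cumulants phi kappa ->
  forall m s, ev kappa (rot m s) = ev kappa s.
Proof.
move=> tr h m s; have [N] := ubnP (size s); elim: N s m => // N IHN s m leN.
have [le|/ltnW mn] := leqP (size s) m; first by rewrite rot_oversize.
case: s mn leN => [|v s]; first by rewrite rot_oversize.
rewrite -(mkseq_nth 0 (v :: s)); set x := nth 0 _; rewrite !size_mkseq /=.
move: (size s) => n mn leN; rewrite -mkseq_shift //.
have := ev_rot_tracial tr m (mkseq x n.+1); rewrite -mkseq_shift //.
(* Only the sum for the unrotated word is reindexed, so that the two sums match term by term in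
   [P]. *)
rewrite !(ev_free _ h) // [RHS](big_NC_rot _ mn) !big_NC_full !big_set1.
rewrite (_ : blocks_image _ _ = [set setT]); last first.
  by rewrite /blocks_image imset_set1 imset_rot_ordT.
rewrite big_set1 !subword_full => E; move: E.
rewrite (eq_bigr (fun P => \prod_(A in blocks_image (rot_ord m) P) ev kappa (subword x A))).
  exact: addIr.
move=> P /andP[PNC PT]; rewrite (big_blocks_image (rot_ord_inj mn)).
apply: eq_bigr => A AP; rewrite subword_rot_ord.
have [j ->] := enum_rot_ord mn A; rewrite map_rot; apply: IHN.
rewrite size_subword card_imset; last exact: rot_ord_inj.
exact: leq_trans (NC_block_lt PNC PT AP) _.
Qed.

End Ev.

(** * The transformation [Delta_star] *)

(** The rotated list starts with the image [m] of [ord0], which fixes the amount of rotation left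
    open by [enum_rot_ord]. *)
Lemma rot_enum_image n m (A : {set 'I_n.+1}) : (m <= n)%N -> ord0 \in A ->
  map (rot_ord m) (enum A) =
  rot (index (inord m) (enum (rot_ord m @: A))) (enum (rot_ord m @: A)).
Proof.
move=> mn A0; have mn' : (m <= n.+1)%N by apply: leqW.
have [j E] := enum_rot_ord mn' A; rewrite E.
have E0 : rot_ord m (ord0 : 'I_n.+1) = inord m.
  by rewrite /rot_ord add0n modn_small.
apply: (rot_to_index (t := behead (map (rot_ord m) (enum A)))); first exact: enum_uniq.
rewrite -E -E0 enum_filter enum_ordSl /= A0 //.
Qed.

Section DeltaEv.
Variables (K : fieldType) (V : lmodType K) (Delta : {linear V -> tensor V 2}).
Implicit Types (phi chi beta kappa kappac : mfamily V) (s : seq V) (x : nat -> V).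

(* The value of [phi] on [b, w, a], where [a (x) b] is [Delta v] *)
Definition Delta_head phi s : K :=
  if s is v :: w then
    \sum_(p <- repr (Delta v)) p.1 *
      ev phi (tnth p.2 ord_max :: rcons w (tnth p.2 ord0))
  else 0.

Lemma iter_Gamma_sum n k (s : formal V n) : (k <= n)%N ->
  iter k (@Gamma K V n) (\sum_(p <- s) p.1 *: tens n p.2) =
  \sum_(p <- s) p.1 *: tens n [tuple of rot k p.2].
Proof.
elim: k => [_|k IHk kn] /=.
  apply: eq_bigr => p _; congr (_ *: tens n _); apply: val_inj.
  by rewrite /= rot0.
rewrite IHk ?(ltnW kn) // linear_sum; apply: eq_bigr => p _.
rewrite linearZ /= GammaE; congr (_ *: tens n _); apply: val_inj => /=.
by rewrite [RHS]rotS ?size_tuple.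
Qed.

(** The [m.+1] letters moved to the back are the prefix and the first factor, so the cut falls
    between the two factors of [ab]. *)
Lemma rot_subst2 n (x : n.-tuple V) (m : 'I_n) (ab : 2.-tuple V) :
  rot m.+1 (subst2 x m ab) =
  tnth ab ord_max :: rcons (drop m.+1 x ++ take m x) (tnth ab ord0).
Proof.
have -> : tval (subst2 x m ab) = take m x ++ ab ++ drop m.+1 x.
  apply: (eq_from_nth (x0 := 0)) => [|i].
    rewrite !size_cat size_takel ?size_drop !size_tuple ?(ltnW (ltn_ord m)) //.
    by have := ltn_ord m; lia.
  rewrite size_tuple => ilt.
  by rewrite (_ : i = val (Ordinal ilt)) // -tnth_nth tnth_mktuple.
case: ab => -[|a [|b [|]]] //= szab; rewrite !(tnth_nth 0) /=.
rewrite -cat_rcons -[X in rot X](_ : size (rcons (take m x) a) = m.+1).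
  by rewrite rot_size_cat /= rcons_cat.
by rewrite size_rcons size_takel // size_tuple ltnW.
Qed.

(** The power of [Gamma] in the [m]-th term brings the second factor of [Delta] to the front and the
    first to the end, as in a word read cyclically from letter [m]. *)
Lemma ev_Delta_star phi s :
  ev (Delta_star Delta phi) s = \sum_(m < size s) Delta_head phi (rot m s).
Proof.
rewrite /ev /= /Delta_tilde linear_sum; apply: eq_bigr => m _.
rewrite Delta_nmE -[Delta _]tclass_repr tclassE /subst_tens tlift_sum /=.
set t := in_tuple s.
have -> : rot m s = tnth t m :: (drop m.+1 s ++ take m s).
  by rewrite /rot (drop_nth 0) // (tnth_nth 0).
rewrite /Delta_head.
have := @iter_Gamma_sum (size s).+1 m.+1
  [seq (p.1, subst2 t m p.2) | p <- repr (Delta (tnth t m))] (ltnW (ltn_ord m)).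
rewrite !big_map /= => ->; rewrite linear_sum; apply: eq_bigr => p _.
by rewrite linearZ /= tlift_tens evE -(rot_subst2 t m p.2).
Qed.

Lemma subword_collapse (y z : nat -> V) n (A : {set 'I_n.+1}) :
  (forall i, (0 < i < n.+1)%N -> z i = y i) ->
  subword z (@collapse n @^-1: A) =
  if ord0 \in A then z 0%N :: rcons (behead (subword y A)) (z n.+1)
  else subword y A.
Proof.
move=> zy; rewrite /subword enum_preim_collapse map_cat -map_comp enum_filter enum_ordSl /=.
have E : map (fun i : 'I_n.+1 => z (uncollapse i))
           (filter (mem A) (map (lift ord0) (enum 'I_n))) =
         map (fun i : 'I_n.+1 => y i) (filter (mem A) (map (lift ord0) (enum 'I_n))).
  rewrite filter_map -!map_comp; apply: eq_map => i /=.
  by rewrite zy // /bump /= add1n ltnS; apply: (ltn_ord i).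
by case: ifP => A0 /=; rewrite E ?cats0 ?cats1.
Qed.

(** For each elementary tensor, [boolean_outer_sum] applies to a word of [n.+2] letters, and gluing
    its two ends gives partitions of [n.+1] points. *)
Lemma Delta_head_boolean chi beta kappa kappac n (y : nat -> V) :
  boolean_cumulants chi beta -> cfree_cumulants chi kappa kappac ->
  Delta_head beta (mkseq y n.+1) =
  \sum_(P in NC n.+1) \prod_(A in P)
     if ord0 \in A then Delta_head kappac (subword y A)
     else ev kappa (subword y A).
Proof.
move=> hb hc; rewrite [mkseq y n.+1]/= /Delta_head.
pose w a b (A : {set 'I_n.+1}) :=
  if ord0 \in A then ev kappac (b :: rcons (behead (subword y A)) a)
  else ev kappa (subword y A).
transitivity (\sum_(p <- repr (Delta (y 0%N))) p.1 *
   \sum_(P in NC n.+1) \prod_(A in P) w (tnth p.2 ord0) (tnth p.2 ord_max) A).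
  apply: eq_bigr => p _; congr (_ * _).
  set a := tnth p.2 ord0; set b := tnth p.2 ord_max.
  (* The word [b, y 1, ..., y n, a]. *)
  pose z i := if i == 0%N then b else if i == n.+1 then a else y i.
  have zy i : (0 < i < n.+1)%N -> z i = y i.
    by rewrite /z; case: eqP => [->//|_]; case: eqP => [->|//]; rewrite ltnn andbF.
  have zn : z n.+1 = a by rewrite /z eqxx.
  have -> : b :: rcons (map y (iota 1 n)) a = mkseq z n.+2.
    rewrite mkseqS zn /mkseq /=; congr (_ :: rcons _ _).
    by apply/eq_in_map => i; rewrite mem_iota add1n => ?; rewrite zy.
  rewrite (boolean_outer_sum _ _ hb hc) /outer_sum big_NC_joined.
  apply: eq_bigr => P _; rewrite big_expand_blocks; apply: eq_bigr => A _.
  rewrite (subword_collapse A zy) inE -uncollapse0 uncollapseK /w zn.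
  by case: (ord0 \in A).
(* Only the block of [ord0] involves the pair [p.2], so the sum over [p] moves into that factor. Its
   subword starts with [y 0], hence the same representative of [Delta (y 0)] occurs there. *)
under eq_bigr do rewrite big_distrr /=.
rewrite exchange_big; apply: eq_bigr => P PNC /=; move: PNC.
rewrite inE => /andP[/partition_elemP[_ _ cov uniqP] _].
have [A0 A0P A00] := cov ord0 (in_setT _).
have w1 A : A \in P -> A != A0 -> (ord0 \in A) = false.
  by move=> AP; apply: contraNF => A1; apply/eqP; apply: (uniqP A A0 AP A0P ord0).
rewrite (bigD1 A0) //= A00.
rewrite (eq_bigr (fun A => ev kappa (subword y A))) => [|A /andP[AP AA0]]; last first.
  by rewrite w1.
have [t yA0] : exists t, subword y A0 = y 0%N :: t.
  by rewrite /subword enum_filter enum_ordSl /= A00 /=; eexists.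
rewrite {1}yA0 /= mulr_suml; apply: eq_bigr => p _; rewrite -mulrA; congr (_ * _).
rewrite (bigD1 A0) //= /w A00 yA0 /=; congr (_ * _).
by apply: eq_bigr => A /andP[AP AA0]; rewrite w1.
Qed.

(** Each position [m] is rotated to the front, treated by [Delta_head_boolean] and rotated back; the
    positions are then grouped by the block containing them. *)
Lemma Delta_star_inf chi beta kappa kappac phi n x :
  boolean_cumulants chi beta -> cfree_cumulants chi kappa kappac ->
  tracial phi -> free_cumulants phi kappa -> (0 < n)%N ->
  ev (Delta_star Delta beta) (mkseq x n) =
  \sum_(P in NC n) \sum_(A0 in P) ev (Delta_star Delta kappac) (subword x A0) *
      \prod_(A in P | A != A0) ev kappa (subword x A).
Proof.
move=> hb hc tr hf; case: n => // n _; rewrite ev_Delta_star size_mkseq.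
pose H (m : 'I_n.+1) (A : {set 'I_n.+1}) :=
  Delta_head kappac (rot (index m (enum A)) (subword x A)).
transitivity (\sum_(m < n.+1) \sum_(P in NC n.+1) \prod_(A in P)
    if m \in A then H m A else ev kappa (subword x A)).
  apply: eq_bigr => m _; have mn : (m <= n)%N by rewrite -ltnS.
  have mn' := leqW mn.
  rewrite -mkseq_shift // (Delta_head_boolean _ _ hb hc) [RHS](big_NC_rot _ mn').
  apply: eq_bigr => P _; rewrite (big_blocks_image (rot_ord_inj mn')).
  apply: eq_bigr => A _; rewrite subword_rot_ord.
  have E0 : rot_ord m (ord0 : 'I_n.+1) = m.
    by apply: val_inj; rewrite /= inordK add0n modn_small.
  have -> : (m \in rot_ord m @: A) = (ord0 \in A).
    by rewrite -[ord0 \in A](mem_imset _ _ (rot_ord_inj mn')) E0.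
  case: ifP => A0; last first.
    (* On unmarked blocks the amount [j] is irrelevant, by cyclic invariance of the free
       cumulants. *)
    by have [j ->] := enum_rot_ord mn' A; rewrite map_rot (ev_rot_cumulant tr hf).
  (* [Delta_head] singles out the first letter, so on the marked block the exact rotation is
     used. *)
  by rewrite rot_enum_image // inord_val map_rot.
rewrite exchange_big; apply: eq_bigr => P PNC.
have /andP[partP _] : partition P setT && noncrossing P by rewrite inE in PNC.
have /partition_elemP[_ _ _ uniqP] := partP.
rewrite (eq_bigl (fun m => m \in [set: 'I_n.+1])) => [|m]; last by rewrite in_setT.
rewrite (set_partition_big _ partP); apply: eq_bigr => A0 A0P.
transitivity (\sum_(m in A0) H m A0 * \prod_(A in P | A != A0) ev kappa (subword x A)).
  apply: eq_bigr => m mA0; rewrite (bigD1 A0) //= mA0; congr (_ * _).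
  apply: eq_bigr => A /andP[AP AA0]; rewrite ifN //.
  by apply: contra AA0 => mA; apply/eqP; apply: (uniqP A A0 AP A0P m).
rewrite -mulr_suml; congr (_ * _); rewrite ev_Delta_star size_subword.
case: (set_0Vmem A0) => [->|[m0 _]]; first by rewrite big_set0 cards0 big_ord0.
(* As [m] runs through [A0], its index in [enum A0] runs through the rotations in
   [ev_Delta_star]. *)
rewrite -big_enum (big_nth m0) big_mkord /= cardE.
by apply: eq_bigr => j _; rewrite /H index_uniq ?enum_uniq.
Qed.

End DeltaEv.

(** * Uniqueness of infinitesimal cumulants and conclusion *)

(** Induction on the length: the one-block partition contributes the cumulant with coefficient 1,
    and all other terms involve shorter words. *)
Lemma inf_free_unique (K : fieldType) (V : lmodType K)
    (kappa kappa1 kappa2 : mfamily V) :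
  (forall n (x : nat -> V), (0 < n)%N ->
    \sum_(P in NC n) \sum_(A0 in P) ev kappa1 (subword x A0) *
      \prod_(A in P | A != A0) ev kappa (subword x A) =
    \sum_(P in NC n) \sum_(A0 in P) ev kappa2 (subword x A0) *
      \prod_(A in P | A != A0) ev kappa (subword x A)) ->
  forall n (x : nat -> V), (0 < n)%N ->
    ev kappa1 (mkseq x n) = ev kappa2 (mkseq x n).
Proof.
move=> eqs n x n0; suff {n x n0} : forall s, (0 < size s)%N -> ev kappa1 s = ev kappa2 s.
  by move=> H; apply: H; rewrite size_mkseq.
move=> s; have [N] := ubnP (size s); elim: N s => // N IHN [//|v s] leN _.
rewrite -(mkseq_nth 0 (v :: s)); set x := nth 0 _.
rewrite /= ltnS in leN; rewrite [size _]/=; move: (size s) leN => n leN.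
have full kap : \sum_(A0 in [set [set: 'I_n.+1]]) ev kap (subword x A0) *
    \prod_(A in [set setT] | A != A0) ev kappa (subword x A) = ev kap (mkseq x n.+1).
  rewrite big_set1 subword_full big_pred0 ?mulr1 // => A.
  by rewrite inE andbN.
have := eqs n.+1 x isT; rewrite !big_NC_full !full.
set S1 := (X in _ + X = _); set S2 := (X in _ = _ + X); have -> : S1 = S2.
  apply: eq_bigr => P /andP[PNC PT]; apply: eq_bigr => A AP; congr (_ * _).
  apply: IHN; rewrite size_subword ?(NC_card_gt0 PNC AP) //.
  exact: leq_trans (NC_block_lt PNC PT AP) _.
exact: addIr.
Qed.

Theorem theorem1p7 (R : realType) (V : lmodType R[i])
    (Delta : {linear V -> tensor V 2})
    (chi beta : mfamily V) (hbeta : boolean_cumulants chi beta)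
    (phi : mfamily V) (hphi : tracial phi)
    (kappa : mfamily V) (hkappa : free_cumulants phi kappa)
    (kappac : mfamily V) (hkappac : cfree_cumulants chi kappa kappac)
    (kappa' : mfamily V)
    (hkappa' : inf_free_cumulants (Delta_star Delta beta) kappa kappa') :
  forall (n : nat), (1 <= n)%N -> forall x : n.-tuple V,
    kappa' n x = Delta_star Delta kappac n x.
Proof.
move=> n n0 x; rewrite !evE -(mkseq_nth 0 x) size_tuple.
apply: (inf_free_unique (kappa := kappa)) n0 => {}n {}x n0.
rewrite -(ev_inf_free _ hkappa') //.
exact: Delta_star_inf hbeta hkappac hphi hkappa n0.
Qed.
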